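(* Let $u^0=(\tau_0,v_0)\in BV(\mathbb{R})\cap L^\infty(\mathbb{R})$ with $\tau_0\ge\beta>0$, let $u\in\mathcal{S}_{\text{weak}}$, and for $0<\delta<\frac{\epsilon}{2}$ let $\psi_\delta$ be the modified front tracking function and $a=a_\delta$ the associated weight, as defined in the context. There exist $\overline{C},\overline{c}>0$ such that, uniformly in $\delta$, $$\overline c\le a(t,x)\le\overline C\quad\text{for any }(t,x)\in\mathbb{R}^+\times\mathbb{R}.$$ Furthermore, for every time $t$ with a wave interaction, and almost every $x$, $$a(t+,x)\le a(t-,x).$$ Moreover, for every time $t$ without a wave interaction, and for every $x$ such that a big shock is located at $x=x_i(t)$, $$\frac{a(t,x_i(t)+)}{a(t,x_i(t)-)}=\begin{cases}C_1&\text{if }x_i\text{ is a }1\text{-shock},\\ \frac1{C_1}&\text{if }x_i\text{ is a }2\text{-shock},\end{cases}$$ and if a small shock of strength $\sigma_i$ is located at $x=x_i(t)$, $$\frac{a(t,x_i(t)+)}{a(t,x_i(t)-)}=\begin{cases}1-C_0\sigma_i&\text{if }x_i\text{ is a }1\text{-shock},\\ 1+C_0\sigma_i&\text{if }x_i\text{ is a }2\text{-shock}.\end{cases}$$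
   Context: **System and solutions.** The system is $\partial_t\tau-\partial_xv=0$, $\partial_tv+\partial_x(1/\tau)=0$ on $\mathbb{R}^+\times\mathbb{R}$, with flux $f(\tau,v)=(-v,1/\tau)$, eigenvalues $\lambda_{1,2}(u)=\mp1/\tau$, entropy $\eta(\tau,v)=\frac{v^2}2-\ln\tau$ and entropy flux $q(\tau,v)=\frac v\tau$. Fix $\hat M,\hat c,\hat C>0$ and $\mathcal{V}_0=\{(\tau,v):|v|\le\hat M,\ \hat c\le\tau\le\hat C\}$. $\mathcal{S}_{\text{weak}}$ is the set of $u\in L^\infty(\mathbb{R}^+\times\mathbb{R};\mathcal{V}_0)$ that are weak solutions satisfying $\partial_t\eta(u)+\partial_xq(u)\le0$ in distributions and the Strong Trace property: for any Lipschitz curve $h(t)$ there are $u_\pm\in L^\infty(\mathbb{R}^+)$ such that for all $T>0$, $\int_0^T\sup_{y\in(0,1/n)}|u(t,h(t)\pm y)-u_\pm(t)|\,dt\to0$ as $n\to\infty$ (for each sign). Relative quantities: $\eta(a|b)=\eta(a)-\eta(b)-\nabla\eta(b)\cdot(a-b)$, $q(a;b)=q(a)-q(b)-\nabla\eta(b)\cdot(f(a)-f(b))$. $BV(\mathbb{R})$ means finite total variation, and $\|\cdot\|_{BV(\mathbb{R})}$ is the total variation. **Wave curves.** Put $w=-\ln\tau$; states are written interchangeably as $(\tau,v)$ or $(w,v)$. Let $W(s)=s$ for $s\le0$ and $W(s)=2\sinh(s/2)$ for $s\ge0$. The $i$-wave curve ($i=1,2$) through a left state $(w_l,v_l)$ is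 $T_i(\sigma)((w_l,v_l))=(w_l+(-1)^{i-1}\sigma,\,v_l-W(\sigma))$; $\sigma>0$ gives an $i$-shock, $\sigma<0$ an $i$-rarefaction. The strength of a wave is $|\sigma|$, its jump in $w$. **Constants and shifts.** $\mathcal{D}\subset(0,\infty)\times\mathbb{R}$ is a compact set, depending only on $\|u^0\|_{BV(\mathbb{R})},\|u^0\|_{L^\infty(\mathbb{R})},\beta$ (and the fixed set $\mathcal{V}_0\subset\mathcal{D}$), containing all values of all the $\psi_\delta$ below. Constants $0<C_0<\frac12$, $0<C_1<1$, $\epsilon>0$, $\hat\lambda>0$, associated with $\mathcal{D}$, have the following known property, for every $u\in\mathcal{S}_{\text{weak}}$, $\overline t\ge0$, $x_0\in\mathbb{R}$, and entropic shock $(u_l,u_r)$ with $u_l,u_r\in\mathcal{D}$ and strength $\sigma$. If $\sigma\ge\frac\epsilon2$ and $a_1,a_2>0$ satisfy $a_2/a_1\le C_1$ (1-shock) or $a_2/a_1\ge1/C_1$ (2-shock), there is a Lipschitz shift $h=h_1:[\overline t,\infty)\to\mathbb{R}$; and if $\sigma<\epsilon$ and $1-2C_0\sigma\le a_2/a_1\le1-\frac{C_0}2\sigma$ (1-shock) or $1+\frac{C_0}2\sigma\le a_2/a_1\le1+2C_0\sigma$ (2-shock), there is a Lipschitz shift $h=h_2:[\overline t,\infty)\to\mathbb{R}$; in each case $h(\overline t)=x_0$ and, with $u_\pm(t)=u(t,h(t)\pm)$, for a.e. $t$, $$a_1(\dot h\,\eta(u_-|u_l)-q(u_-;u_l))-a_2(\dot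 h\,\eta(u_+|u_r)-q(u_+;u_r))\le0,$$ and $-\hat\lambda\le\dot h<0$ a.e. for 1-shocks, $0<\dot h\le\hat\lambda$ a.e. for 2-shocks. The constants $C_1$ and $\epsilon$ may be taken arbitrarily small, and are taken sufficiently small; in particular $C_0\epsilon\le\frac12$. **Riemann solver with parameter $\delta$.** Given left and right states $u_l,u_r$ meeting at $(\overline t,\overline x)$, let $\sigma_1,\sigma_2$ be determined by $(w_r,v_r)=T_2(\sigma_2)\circ T_1(\sigma_1)((w_l,v_l))$, and set $u_0=u_l$, $u_1=T_1(\sigma_1)(u_l)$ (the intermediate state), $u_2=u_r$. If $\sigma_i<0$, the $i$-rarefaction is partitioned into $p_i=\lceil|\sigma_i|/\delta\rceil$ fronts: for $j=1,\dots,p_i$, $u_{i,j}=T_i(j\sigma_i/p_i)(u_{i-1})$ is the state to the right of the $j$-th front, which travels along $x_{i,j}(t)=\overline x+(t-\overline t)\lambda_i(u_{i,j})$. If $\sigma_i>0$, the $i$-shock is a single front traveling along a shift starting at $(\overline t,\overline x)$: a shift $h_1$ if the shock is labeled ''big'' (with ratio $a_2/a_1=C_1$ for a 1-shock, $1/C_1$ for a 2-shock), a shift $h_2$ if it is labeled ''small'' (with ratio $1-C_0\sigma_i$ for a 1-shock, $1+C_0\sigma_i$ for a 2-shock). **Front tracking.** Approximate $u^0$ by a piecewise constant $\psi^0_\delta=(\tau_\delta^0,v_\delta^0)$ with $\|\psi^0_\delta\|_{BV(\mathbb{R})}\le2\|u^0\|_{BV(\mathbb{R})}$, $\|\psi_\delta^0\|_{L^\infty(\mathbb{R})}\le\|u^0\|_{L^\infty(\mathbb{R})}$,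 $\tau_\delta^0\ge\beta$. Solve all Riemann problems at $t=0$ with the Riemann solver with parameter $\delta$ (the $i$-rarefactions partitioned into $p_i$ fronts traveling along the lines $x_{i,j}(t)$, each shock a single front traveling along a shift $h_1$ if labeled big and $h_2$ if labeled small); shocks of strength $\ge\epsilon$ are labeled big, the others small. Let waves propagate, and whenever waves meet solve the new Riemann problem with the solver, labeling outgoing shocks as below; $\psi_\delta$ is the resulting piecewise constant function. By slightly perturbing wave speeds, at each time at most one interaction occurs and it involves exactly two waves. **Interactions at $t^*>0$ and labels.** Two rarefaction fronts of the same family never meet. If a 1-wave meets a 2-wave (trivial interaction), the waves pass through each other keeping their strengths and labels. Otherwise (in either left-right order): (1) two big 1-shocks: outgoing big 1-shock and 2-rarefaction. (2) a big and a small 1-shock: outgoing big 1-shock and 2-rarefaction. (3) a big 1-shock and a 1-rarefaction: outgoing 1-shock and small 2-shock; the 1-shock is big if its strength is $\ge\frac\epsilon2$ (3A), small otherwise (3B). (4) two small 1-shocks: outgoing 1-shock and 2-rarefaction; the 1-shock is small if its strength is $<\epsilon$ (4A), big if $\ge\epsilon$ (4B). (5) a small 1-shock and a 1-rarefaction: outgoing small 1-shock and small 2-shock (5A), or 1-rarefaction and small 2-shock (5B). (6)–(10) are the mirror images of (1)–(5), obtained by exchanging the roles of the families 1 and 2 (so, e.g., (9B): two small 2-shocks produce a 1-rarefaction and a 2-shock of strength $\ge\epsilon$, labeled big). **The weight.** $a(t,x)=C_1^{L(t)}\,Q(t)\,\prod_{i:\text{shock}}\xi_i(t,x)$, the product being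 over the shocks present in $\psi_\delta$ at time $t$, where: - $L(t)$ is the number of interactions of type 1, 3B or 9B at times in $(0,t)$. - $Q(t)=\prod_{k\in K(t)}k$, where $K(t)$ is a collection of numbers counted with multiplicity, $K(0+)=\emptyset$ (empty product $=1$), to which one number is added at each interaction of the following types. Type 2: $1-C_0\sigma$, $\sigma$ the strength of the incoming small 1-shock. Type 3A: $\frac1{1+C_0\sigma_2'}$. Type 4A: $\min\left(\frac{(1-C_0\sigma)(1-C_0\tilde\sigma)}{1-C_0\sigma_1'},1\right)$, $\sigma,\tilde\sigma$ the strengths of the two incoming 1-shocks. Type 5A: $\frac{1-C_0\sigma}{(1-C_0\sigma_1')(1+C_0\sigma_2')}$. Type 5B: $\frac{1-C_0\sigma}{1+C_0\sigma_2'}$. In types 5A and 5B, $\sigma$ is the strength of the incoming 1-shock; $\sigma_1'$ and $\sigma_2'$ denote the strengths of the outgoing 1-shock and 2-shock. - For a shock at $x_i(t)$ of strength $\sigma_i$, $\xi_i(t,x)=1$ for $x<x_i(t)$, and for $x>x_i(t)$: $\xi_i=1-C_0\sigma_i$ (small 1-shock), $1+C_0\sigma_i$ (small 2-shock), $C_1$ (big 1-shock), $\frac1{C_1}$ (big 2-shock). *)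

(* Defs.v *)
From HB Require Import structures.
From mathcomp Require Import all_boot all_order all_algebra.
From mathcomp Require Import all_classical all_reals all_analysis ess_sup_inf.

Set Implicit Arguments.
Unset Strict Implicit.
Unset Printing Implicit Defensive.

Import Order.TTheory GRing.Theory Num.Theory.
Import numFieldNormedType.Exports.

Local Open Scope classical_set_scope.
Local Open Scope ring_scope.

(** * The p-system for an isothermal gas

    A state is a pair (tau, v); the plane of space-time points is made of the
    pairs (t, x). *)

Definition flux (R : realType) (u : R * R) : R * R := (- u.2, u.1^-1).

Definition eta (R : realType) (u : R * R) : R := u.2 ^+ 2 / 2 - ln u.1.

Definition eflux (R : realType) (u : R * R) : R := u.2 / u.1.

Definition grad_eta (R : realType) (u : R * R) : R * R := (- u.1^-1, u.2).

Definition dotp (R : realType) (a b : R * R) : R := a.1 * b.1 + a.2 * b.2.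

Definition rel_eta (R : realType) (a b : R * R) : R :=
  eta a - eta b - dotp (grad_eta b) (a - b).

Definition rel_eflux (R : realType) (a b : R * R) : R :=
  eflux a - eflux b - dotp (grad_eta b) (flux a - flux b).

(* The library norm of R * R is the max norm. *)
Definition enorm (R : realType) (a : R * R) : R := Num.sqrt (dotp a a).

(** * Function spaces *)

Definition Linfty_norm (R : realType) (A : set R) (f : R -> R * R) : \bar R :=
  ess_sup lebesgue_measure ((fun x => (enorm (f x))%:E) \_ A).

Definition Linfty (R : realType) (A : set R) (f : R -> R * R) : Prop :=
  [/\ measurable_fun A (fun x => (f x).1), measurable_fun A (fun x => (f x).2)
    & (Linfty_norm A f < +oo)%E].

Definition total_var (R : realType) (f : R -> R * R) : \bar R :=
  ereal_sup [set z | exists a s, path <%R a s /\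
    z = (\sum_(d <- pairmap (fun x y => enorm (f y - f x)) a s) d)%:E].

Definition dt (R : realType) (phi : R * R -> R) : R * R -> R :=
  fun p => derive1 (fun t => phi (t, p.2)) p.1.

Definition dx (R : realType) (phi : R * R -> R) : R * R -> R :=
  fun p => derive1 (fun x => phi (p.1, x)) p.2.

(* [s] lists the variables of an iterated partial derivative, [true] being t. *)
Definition smooth2 (R : realType) (phi : R * R -> R) : Prop :=
  forall s : seq bool,
    let g := foldr (fun b => if b then @dt R else @dx R) phi s in
    continuous g /\
    forall p, derivable (fun t => g (t, p.2)) p.1 1 /\
              derivable (fun x => g (p.1, x)) p.2 1.

Definition test_fun (R : realType) (phi : R * R -> R) : Prop :=
  smooth2 phi /\ exists a b r, 0 < a /\
    forall t x, phi (t, x) != 0 -> a <= t <= b /\ `|x| <= r.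

Definition half_plane (R : realType) : set (R * R) := [set p | 0 < p.1].

Notation leb2 R := (@lebesgue_measure R \x @lebesgue_measure R)%E.

(** * The class of weak solutions with strong traces *)

(* [us] is the trace of [u] on the right ([s = 1]) or on the left ([s = -1])
   of the curve [h]. Elements of L^oo being defined almost everywhere, the
   supremum over (0, 1/n) is an essential supremum. *)
Definition is_trace (R : realType) (u : R * R -> R * R) (t0 : R) (h : R -> R)
    (s : R) (us : R -> R * R) : Prop :=
  Linfty `]t0, +oo[ us /\
  forall T, t0 < T ->
    (fun n : nat => \int[lebesgue_measure]_(t in `]t0, T[)
       ess_sup lebesgue_measure
         ((fun y : R => (enorm (u (t, (h t + s * y)%R) - us t)%R)%:E)
            \_ `]0%R, (n.+1%:R^-1)%R[))%E @ \oo --> 0%E.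

Definition strong_trace (R : realType) (u : R * R -> R * R) : Prop :=
  forall h : R -> R, [lipschitz h t | t in `[0, +oo[] ->
    exists um up, is_trace u 0 h (-1) um /\ is_trace u 0 h 1 up.

Definition V0 (R : realType) (Mh ch Ch : R) : set (R * R) :=
  [set p | `|p.2| <= Mh /\ ch <= p.1 <= Ch].

Definition S_weak (R : realType) (Mh ch Ch : R) (u : R * R -> R * R) : Prop :=
  [/\ [/\ measurable_fun (@half_plane R) (fun p => (u p).1),
          measurable_fun (@half_plane R) (fun p => (u p).2)
        & {ae leb2 R, forall p, half_plane p -> V0 Mh ch Ch (u p)}],
      (forall phi, test_fun phi ->
        (\int[leb2 R]_(p in @half_plane R)
          ((u p).1 * dt phi p + (flux (u p)).1 * dx phi p)%:E = 0)%E /\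
        (\int[leb2 R]_(p in @half_plane R)
          ((u p).2 * dt phi p + (flux (u p)).2 * dx phi p)%:E = 0)%E),
      (forall phi, test_fun phi -> (forall p, 0 <= phi p) ->
        (0 <= \int[leb2 R]_(p in @half_plane R)
          (eta (u p) * dt phi p + eflux (u p) * dx phi p)%:E)%E)
    & strong_trace u].

(** * Wave curves *)

Variant wfamily := F1 | F2.

Definition other (i : wfamily) : wfamily := if i is F1 then F2 else F1.

Definition wave_sign (R : realType) (i : wfamily) : R := if i is F1 then 1 else -1.

Definition lambda (R : realType) (i : wfamily) (u : R * R) : R :=
  - wave_sign R i / u.1.

(* For s >= 0 this is 2 sinh (s / 2). *)
Definition Wfun (R : realType) (s : R) : R :=
  if s <= 0 then s else expR (s / 2) - expR (- (s / 2)).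

Definition wcoord (R : realType) (u : R * R) : R := - ln u.1.

Definition of_wv (R : realType) (w v : R) : R * R := (expR (- w), v).

Definition Tw (R : realType) (i : wfamily) (sigma : R) (u : R * R) : R * R :=
  of_wv (wcoord u + wave_sign R i * sigma) (u.2 - Wfun sigma).

(** * Shifts *)

(* The shift is only relevant on [tb, +oo[, although [h] is a total function. *)
Definition is_shift (R : realType) (u : R * R -> R * R) (lamhat : R)
    (i : wfamily) (ul ur : R * R) (a1 a2 tb x0 : R) (h : R -> R) : Prop :=
  [/\ [lipschitz h t | t in `[tb, +oo[], h tb = x0
    & exists um up, [/\ is_trace u tb h (-1) um, is_trace u tb h 1 up
      & {ae lebesgue_measure, forall t : R, tb < t ->
          [/\ derivable h t 1,
              a1 * (derive1 h t * rel_eta (um t) ul - rel_eflux (um t) ul)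
              - a2 * (derive1 h t * rel_eta (up t) ur - rel_eflux (up t) ur) <= 0
            & if i is F1 then - lamhat <= derive1 h t < 0
              else 0 < derive1 h t <= lamhat]}]].

Definition shift_property (R : realType) (Mh ch Ch : R) (D : set (R * R))
    (C0 C1 eps lamhat : R) : Prop :=
  forall (u : R * R -> R * R) (tb x0 sigma : R) (i : wfamily) (ul ur : R * R),
    S_weak Mh ch Ch u -> 0 <= tb -> D ul -> D ur ->
    0 < sigma -> Tw i sigma ul = ur ->
    forall a1 a2 : R, 0 < a1 -> 0 < a2 ->
    (eps / 2 <= sigma ->
      (if i is F1 then a2 / a1 <= C1 else C1^-1 <= a2 / a1) ->
      exists h1, is_shift u lamhat i ul ur a1 a2 tb x0 h1) /\
    (sigma < eps ->
      (if i is F1 then 1 - 2 * C0 * sigma <= a2 / a1 <= 1 - C0 / 2 * sigma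
       else 1 + C0 / 2 * sigma <= a2 / a1 <= 1 + 2 * C0 * sigma) ->
      exists h2, is_shift u lamhat i ul ur a1 a2 tb x0 h2).

(** * Fronts and the Riemann solver *)

(* A front is a shock if [0 < str] and a rarefaction front if [str < 0]. The
   label [big] (as opposed to small) is meaningful for shocks only; [pos] is
   relevant between the birth of the front and its next interaction. *)
Record front (R : realType) := Front {
  fam : wfamily;
  str : R;
  big : bool;
  lst : R * R;
  rst : R * R;
  pos : R -> R }.

Section fronts.
Context {R : realType}.
Implicit Types f : front R.

Definition is_shock f : bool := 0 < str f.
Definition is_rar f : bool := str f < 0.
Definition is_big f : bool := is_shock f && big f.
Definition is_small f : bool := is_shock f && ~~ big f.

End fronts.

(* The ratio a_2/a_1 across a shock of family [i], strength [sigma] and label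
   [b]; it is also the value of xi to the right of the shock. *)
Definition jump_ratio (R : realType) (C0 C1 : R) (i : wfamily) (b : bool)
    (sigma : R) : R :=
  match i, b with
  | F1, false => 1 - C0 * sigma
  | F2, false => 1 + C0 * sigma
  | F1, true => C1
  | F2, true => C1^-1
  end.

(* [y] starts like [x] at time [tb] and its speed differs by at most [kap]. *)
Definition perturbed (R : realType) (kap tb : R) (x y : R -> R) : Prop :=
  y tb = x tb /\
  forall s t, tb <= s -> s <= t ->
    `|(y t - x t) - (y s - x s)| <= kap * (t - s).

(* [out] is what the solver emits at (tb, xb) for the [i]-wave of signed
   strength [sigma] with left state [ul]; [b] is the label of a shock. *)
Definition wave_fan (R : realType) (u : R * R -> R * R)
    (C0 C1 lamhat delta kap : R) (i : wfamily) (sigma : R) (b : bool)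
    (ul : R * R) (tb xb : R) (out : seq (front R)) : Prop :=
  if sigma < 0 then
    let p := `|Num.ceil (`|sigma| / delta)|%N in
    let st j := Tw i (j%:R * sigma / p%:R) ul in
    exists y : nat -> R -> R,
      (forall j, perturbed kap tb
         (fun t => xb + (t - tb) * lambda i (st j)) (y j)) /\
      out = [seq Front i (sigma / p%:R) false (st j.-1) (st j) (y j)
            | j <- iota 1 p]
  else if 0 < sigma then
    exists a1 a2 h y,
      [/\ 0 < a1, 0 < a2, a2 / a1 = jump_ratio C0 C1 i b sigma,
          is_shift u lamhat i ul (Tw i sigma ul) a1 a2 tb xb h
        & perturbed kap tb h y /\
          out = [:: Front i sigma b ul (Tw i sigma ul) y]]
  else out = [::].

Definition riemann (R : realType) (u : R * R -> R * R)
    (C0 C1 lamhat delta kap : R) (sigma : wfamily -> R) (b : wfamily -> bool)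
    (ul ur : R * R) (tb xb : R) (out : seq (front R)) : Prop :=
  let um := Tw F1 (sigma F1) ul in
  Tw F2 (sigma F2) um = ur /\
  exists out1 out2,
    [/\ wave_fan u C0 C1 lamhat delta kap F1 (sigma F1) (b F1) ul tb xb out1,
        wave_fan u C0 C1 lamhat delta kap F2 (sigma F2) (b F2) um tb xb out2
      & out = out1 ++ out2].

(** * Interactions *)

Variant icase := c1 | c2 | c3A | c3B | c4A | c4B | c5A | c5B.

(* [Same F1 c] are the types (1)-(5), [Same F2 c] their mirror images
   (6)-(10): [Same F2 c4B] is (9B). [Trivial] is a meeting of waves of
   different families. *)
Variant itype := Trivial | Same of wfamily & icase.

(* [eout i] and [elab i] are the signed strength of the outgoing [i]-wave and
   its label if it is a shock. *)
Record event (R : realType) := Event {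
  etype : itype;
  einl : front R;
  einr : front R;
  eout : wfamily -> R;
  elab : wfamily -> bool }.

Definition incoming (R : realType) (P Q : front R -> bool) (e : event R) : bool :=
  P (einl e) && Q (einr e) || Q (einl e) && P (einr e).

(* Two rarefaction fronts of the same family never meet. In [c5B] the value
   [eout e i = 0] is the limit case where the shock and the rarefaction cancel
   and no outgoing wave of their family is left. *)
Definition same_rule (R : realType) (eps : R) (i : wfamily) (c : icase)
    (e : event R) : Prop :=
  let s := eout e i in
  let s' := eout e (other i) in
  let b := elab e i in
  let b' := elab e (other i) in
  match c with
  | c1 => [/\ incoming is_big is_big e, 0 < s, b & s' < 0]
  | c2 => [/\ incoming is_big is_small e, 0 < s, b & s' < 0]
  | c3A => [/\ incoming is_big is_rar e, 0 < s, eps / 2 <= s, b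
             & 0 < s' /\ ~~ b']
  | c3B => [/\ incoming is_big is_rar e, 0 < s, s < eps / 2, ~~ b
             & 0 < s' /\ ~~ b']
  | c4A => [/\ incoming is_small is_small e, 0 < s, s < eps, ~~ b & s' < 0]
  | c4B => [/\ incoming is_small is_small e, 0 < s, eps <= s, b & s' < 0]
  | c5A => [/\ incoming is_small is_rar e, 0 < s, ~~ b, 0 < s' & ~~ b']
  | c5B => [/\ incoming is_small is_rar e, s <= 0, 0 < s' & ~~ b']
  end.

Definition event_rule (R : realType) (eps : R) (e : event R) : Prop :=
  match etype e with
  | Trivial =>
      [/\ fam (einr e) = other (fam (einl e)),
          eout e (fam (einl e)) = str (einl e),
          eout e (fam (einr e)) = str (einr e),
          elab e (fam (einl e)) = big (einl e)
        & elab e (fam (einr e)) = big (einr e)]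
  | Same i c => [/\ fam (einl e) = i, fam (einr e) = i & same_rule eps i c e]
  end.

(* At time [t] the two incoming fronts of [e], and no others, meet; the fronts
   [fs] present before [t] become [fs']. *)
Definition interaction (R : realType) (u : R * R -> R * R)
    (C0 C1 eps lamhat delta kap : R) (t : R) (e : event R)
    (fs fs' : seq (front R)) : Prop :=
  exists pre post out,
    [/\ fs = pre ++ [:: einl e; einr e] ++ post,
        sorted <%R [seq pos f t | f <- pre ++ einl e :: post],
        pos (einl e) t = pos (einr e) t,
        event_rule eps e
      & riemann u C0 C1 lamhat delta kap (eout e) (elab e)
          (lst (einl e)) (rst (einr e)) t (pos (einl e) t) out /\
        fs' = pre ++ out ++ post].

(** * Front tracking *)

(* The right-continuous step function with value [s] near -oo, jumping to
   [j.2] at [j.1] for each [j] in [js]. *)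
Definition step_fun (R : realType) (s : R * R) (js : seq (R * (R * R))) (x : R)
    : R * R :=
  foldl (fun a j => if j.1 <= x then j.2 else a) s js.

(* [ft_time k.+1] is the time of the [k.+1]-st interaction, described by
   [ft_event k.+1], and is +oo if there are fewer interactions; [ft_fronts k]
   lists from left to right the fronts present in between [ft_time k] and
   [ft_time k.+1]. *)
Record ft (R : realType) := Ft {
  ft_left : R * R;
  ft_jumps : seq (R * (R * R));
  ft_time : nat -> \bar R;
  ft_fronts : nat -> seq (front R);
  ft_event : nat -> event R }.

(* The number of interactions at times in (0, t). *)
Definition ft_index (R : realType) (d : ft R) (t : R) : nat :=
  xget 0%N [set k | ((ft_time d k < t%:E)%E \/ k = 0%N) /\
                    (t%:E <= ft_time d k.+1)%E].

(* The fronts present at time [t]; at the time of an interaction these are the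
   incoming ones. *)
Definition fronts_at (R : realType) (d : ft R) (t : R) : seq (front R) :=
  ft_fronts d (ft_index d t).

Definition psi0 (R : realType) (d : ft R) : R -> R * R :=
  step_fun (ft_left d) (ft_jumps d).

Definition psi (R : realType) (d : ft R) (t : R) : R -> R * R :=
  step_fun (ft_left d) [seq (pos f t, rst f) | f <- fronts_at d t].

Definition interaction_time (R : realType) (d : ft R) (t : R) : Prop :=
  exists k, ft_time d k.+1 = t%:E.

Fixpoint initial_fronts (R : realType) (u : R * R -> R * R)
    (C0 C1 eps lamhat delta kap : R) (ul : R * R) (js : seq (R * (R * R)))
    (fs : seq (front R)) : Prop :=
  if js is (x, ur) :: js' then
    exists sigma out fs',
      [/\ riemann u C0 C1 lamhat delta kap sigma (fun i => eps <= sigma i)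
            ul ur 0 x out,
          initial_fronts u C0 C1 eps lamhat delta kap ur js' fs'
        & fs = out ++ fs']
  else fs = [::].

Definition initial_approx (R : realType) (u0 : R -> R * R) (beta : R)
    (d : ft R) : Prop :=
  [/\ sorted <%R [seq j.1 | j <- ft_jumps d],
      (total_var (psi0 d) <= 2%:E * total_var u0)%E,
      (Linfty_norm setT (psi0 d) <= Linfty_norm setT u0)%E
    & forall x, beta <= (psi0 d x).1].

(* [kap] bounds the perturbation of the wave speeds. Having [ft_time d] tend to
   +oo is what makes psi_delta, L and K defined for all times. *)
Definition front_tracking (R : realType) (u : R * R -> R * R) (D : set (R * R))
    (C0 C1 eps lamhat : R) (u0 : R -> R * R) (beta delta kap : R) (d : ft R)
    : Prop :=
  [/\ initial_approx u0 beta d,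
      [/\ ft_time d 0%N = 0%E,
          forall k, (ft_time d k <= ft_time d k.+1)%E,
          forall k, (ft_time d k < +oo)%E -> (ft_time d k < ft_time d k.+1)%E
        & forall t : R, exists k, (t%:E < ft_time d k)%E],
      initial_fronts u C0 C1 eps lamhat delta kap (ft_left d) (ft_jumps d)
        (ft_fronts d 0%N),
      forall k t, (ft_time d k < t%:E < ft_time d k.+1)%E ->
        sorted <%R [seq pos f t | f <- ft_fronts d k]
    & (forall k t, ft_time d k.+1 = t%:E ->
        interaction u C0 C1 eps lamhat delta kap t (ft_event d k.+1)
          (ft_fronts d k) (ft_fronts d k.+1)) /\
      (forall t x, 0 <= t -> D (psi d t x))].

(** * The weight *)

Definition counted_in_L (ty : itype) : bool :=
  match ty with
  | Same F1 c1 | Same F1 c3B | Same F2 c4B => true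
  | _ => false
  end.

Definition Lnum (R : realType) (d : ft R) (t : R) : nat :=
  count (fun k => counted_in_L (etype (ft_event d k))) (iota 1 (ft_index d t)).

Definition small_str (R : realType) (e : event R) : R :=
  if is_small (einl e) then str (einl e) else str (einr e).

(* The numbers, at most one, added to K by an interaction. *)
Definition added_to_K (R : realType) (C0 : R) (e : event R) : seq R :=
  let s := small_str e in
  let s1 := eout e F1 in
  let s2 := eout e F2 in
  match etype e with
  | Same F1 c2 => [:: 1 - C0 * s]
  | Same F1 c3A => [:: 1 / (1 + C0 * s2)]
  | Same F1 c4A =>
      [:: Num.min ((1 - C0 * str (einl e)) * (1 - C0 * str (einr e))
                   / (1 - C0 * s1)) 1]
  | Same F1 c5A => [:: (1 - C0 * s) / ((1 - C0 * s1) * (1 + C0 * s2))]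
  | Same F1 c5B => [:: (1 - C0 * s) / (1 + C0 * s2)]
  | _ => [::]
  end.

Definition Kseq (R : realType) (C0 : R) (d : ft R) (t : R) : seq R :=
  flatten [seq added_to_K C0 (ft_event d k) | k <- iota 1 (ft_index d t)].

Definition Qprod (R : realType) (C0 : R) (d : ft R) (t : R) : R :=
  \prod_(k <- Kseq C0 d t) k.

(* The value at the position of the shock itself is immaterial. *)
Definition xi (R : realType) (C0 C1 : R) (f : front R) (t x : R) : R :=
  if x <= pos f t then 1 else jump_ratio C0 C1 (fam f) (big f) (str f).

Definition weight (R : realType) (C0 C1 : R) (d : ft R) (t x : R) : R :=
  C1 ^+ Lnum d t * Qprod C0 d t *
  \prod_(f <- fronts_at d t | is_shock f) xi C0 C1 f t x.

(* The front [f] is present at time [t]. *)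
Definition present (R : realType) (d : ft R) (t : R) (f : front R) : Prop :=
  exists pre post, fronts_at d t = pre ++ f :: post.

(* Main.v *)
(** The weight is controlled by a Glimm-type potential. In the coordinates [(w, v)] an
    interaction of two [i]-waves of strengths [a] and [b] produces an [i]-wave [s] and a
    wave [s'] of the other family with [s - s' = a + b] and [W s + W s' = W a + W b].
    As [W s - s] is nondecreasing, this implies that the total strength of the waves never
    increases, that it decreases by at least a multiple of [s'] when a shock meets a
    rarefaction, and that, when two shocks merge, it is conserved but part of it turns into
    a rarefaction, in an amount bounded below in terms of [a] and [b]. Hence a suitable
    combination of the total strength, the strength of the shocks and the number of big
    shocks is nonnegative and decreases at each interaction by at least a multiple of
    minus the logarithm of the factor by which the interaction multiplies C1^L Q. This
    bounds C1^L Q from below, and the product over the shocks is bounded in terms of the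
    total strength, hence of the total variation of the data. *)

Require Import Defs.
From HB Require Import structures.
From mathcomp Require Import all_boot all_order all_algebra.
From mathcomp Require Import all_classical all_reals all_analysis.
From mathcomp Require Import ring lra.
From Stdlib Require List.

Set Implicit Arguments.
Unset Strict Implicit.
Unset Printing Implicit Defensive.

Import Order.TTheory GRing.Theory Num.Theory.
Import numFieldNormedType.Exports.

Local Open Scope classical_set_scope.
Local Open Scope ring_scope.

(** * The function [W] and the algebra of two interacting waves *)

Section wave_function.
Context {R : realType}.
Implicit Types a b s x y A : R.

(** The derivative of [exp z - exp (- z) - 2 z] is the square of [exp (z / 2) - exp (- (z / 2))]. *)
Lemma sinh_excess_le x y : x <= y ->
  expR x - expR (- x) - 2 * x <= expR y - expR (- y) - 2 * y.
Proof.
pose f : R -> R := fun z => expR z - expR (- z) - 2 * z.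
have df (z : R) : is_derive z 1 f (expR z + expR (- z) - 2).
  by apply: is_derive_eq; rewrite [_%:A]mulr1; ring.
move=> xy; rewrite -subr_ge0.
have [z _ ] : exists2 z, z \in `[x, y]%R &
    f y - f x = (expR z + expR (- z) - 2) * (y - x).
  apply: MVT_segment => //; apply: continuous_subspaceT => z.
  by apply/differentiable_continuous/derivable1_diffP.
rewrite /f => ->; apply: mulr_ge0; last by rewrite subr_ge0.
have -> : expR z + expR (- z) - 2 = (expR (z / 2) - expR (- (z / 2))) ^+ 2.
  have e0 := expRxMexpNx_1 (z / 2).
  rewrite {1 2}(_ : z = z / 2 + z / 2); last by field.
  by rewrite opprD !expRD; nra.
exact: sqr_ge0.
Qed.

Lemma WfunE_le0 s : s <= 0 -> Wfun s = s.
Proof. by rewrite /Wfun => ->. Qed.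

Lemma WfunE_ge0 s : 0 <= s -> Wfun s = expR (s / 2) - expR (- (s / 2)).
Proof.
rewrite /Wfun le_eqVlt => /predU1P[<-|s0]; last by rewrite leNgt s0.
by rewrite lexx mul0r oppr0 subrr.
Qed.

Lemma Wfun0 : Wfun 0 = 0 :> R.
Proof. exact: WfunE_le0. Qed.

(** [W s - s] vanishes for [s <= 0], and for [s >= 0] it is the preceding excess at [s / 2]. The
    comparisons of incoming with outgoing strengths rest on this monotonicity. *)
Lemma Wfun_excess_le x y : x <= y -> Wfun x - x <= Wfun y - y.
Proof.
have pos (u v : R) : 0 <= u -> u <= v -> Wfun u - u <= Wfun v - v.
  move=> u0 uv; rewrite (WfunE_ge0 u0) (WfunE_ge0 (le_trans u0 uv)).
  have uv2 : u / 2 <= v / 2 by lra.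
  have := sinh_excess_le uv2; lra.
move=> xy; have [x0|x0] := leP 0 x; first exact: pos.
rewrite (WfunE_le0 (ltW x0)) subrr.
have [y0|y0] := leP 0 y; last by rewrite (WfunE_le0 (ltW y0)) subrr.
by have := pos 0 y (lexx _) y0; rewrite Wfun0 subrr.
Qed.

Lemma Wfun_ge_id s : s <= Wfun s.
Proof.
have [s0|/ltW s0] := leP s 0; first by rewrite WfunE_le0.
have := Wfun_excess_le s0; rewrite Wfun0; lra.
Qed.

(** Both exponentials are compared through [1 + d <= expR d] at [d = x / 2 - y / 2]; the constant is
    not sharp. *)
Lemma Wfun_lipschitz A x y : 0 <= x -> x <= y -> y <= A ->
  Wfun y - Wfun x <= (expR A + 1) * (y - x).
Proof.
move=> x0 xy yA; have y0 := le_trans x0 xy.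
rewrite !WfunE_ge0//.
have yA2 : expR (y / 2) <= expR A by rewrite ler_expR; lra.
have x1 : expR (- (x / 2)) <= 1 by rewrite expR_le1; lra.
have d := expR_ge1Dx (x / 2 - y / 2).
have p1 := expR_gt0 (y / 2).
have p2 := expR_gt0 (- (x / 2)).
have e1 : expR (x / 2) = expR (y / 2) * expR (x / 2 - y / 2).
  by rewrite -expRD; congr expR; ring.
have e2 : expR (- (y / 2)) = expR (- (x / 2)) * expR (x / 2 - y / 2).
  by rewrite -expRD; congr expR; ring.
rewrite e1 e2.
set D := expR (x / 2 - y / 2) in d *.
have h1 : expR (y / 2) - expR (y / 2) * D <= expR (y / 2) * (y / 2 - x / 2) by nra.
have h2 : expR (- (x / 2)) - expR (- (x / 2)) * D <=
    expR (- (x / 2)) * (y / 2 - x / 2) by nra.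
by nra.
Qed.

(** By the addition formula the difference is [W b (cosh (a / 2) - 1) + W a (cosh (b / 2) - 1)], and
    [cosh (c / 2) - 1 = 2 sinh (c / 4) ^ 2] is at least [c ^ 2 / 8]. Only the first term is kept. *)
Lemma Wfun_superadd a b : 0 <= a -> 0 <= b ->
  b * a ^+ 2 / 8 <= Wfun (a + b) - Wfun a - Wfun b.
Proof.
move=> a0 b0.
have ab0 : 0 <= a + b by exact: addr_ge0.
have cosh_ge (c : R) : 0 <= c -> c ^+ 2 / 8 <= (expR (c / 2) + expR (- (c / 2))) / 2 - 1.
  move=> c0; have c20 : 0 <= c / 2 by lra.
  have := Wfun_ge_id (c / 2); rewrite WfunE_ge0//.
  have e0 := expRxMexpNx_1 (c / 2 / 2).
  set p := expR _ in e0 *; set q := expR _ in e0 *.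
  have -> : expR (c / 2) = p * p by rewrite -expRD -splitr.
  have -> : expR (- (c / 2)) = q * q by rewrite -expRD -opprD -splitr.
  by nra.
have ca := cosh_ge a a0; have cb := cosh_ge b b0.
have wa := Wfun_ge_id a; have wb := Wfun_ge_id b.
have -> : Wfun (a + b) - Wfun a - Wfun b =
    Wfun b * ((expR (a / 2) + expR (- (a / 2))) / 2 - 1) +
    Wfun a * ((expR (b / 2) + expR (- (b / 2))) / 2 - 1).
  by rewrite !WfunE_ge0// mulrDl opprD !expRD; field.
set x := _ / 2 - 1 in ca *; set y := _ / 2 - 1 in cb *.
have a2 := sqr_ge0 a; have b2 := sqr_ge0 b.
have h : b * (a ^+ 2 / 8) <= Wfun b * x by apply: ler_pM => //; lra.
have : 0 <= Wfun a * y by apply: mulr_ge0; lra.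
lra.
Qed.

(* Interactions of two waves of the same family: [s] and [s'] are the signed
   strengths of the outgoing waves of that family and of the other one. *)

Lemma merge_shocks A a b s s' : 0 < a -> 0 < b -> s' < 0 -> a + b <= A ->
    s - s' = a + b -> Wfun s + Wfun s' = Wfun a + Wfun b ->
  [/\ a <= s, b <= s & b * a ^+ 2 <= 8 * (expR A + 2) * - s'].
Proof.
move=> a0 b0 s'0 abA sE WE.
have wa := Wfun_ge_id a; have wb := Wfun_ge_id b.
rewrite (WfunE_le0 (ltW s'0)) in WE.
have incr (c : R) : Wfun c < Wfun s -> c <= s.
  move=> h; rewrite leNgt; apply/negP => sc.
  by have := Wfun_excess_le (ltW sc); lra.
have sa : a <= s by apply: incr; lra.
have sb : b <= s by apply: incr; lra.
split=> //.
(* [W (a + b) - W s] is the superadditivity defect at [a], [b] minus the size [- s'] of the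
   rarefaction; it is also at most the Lipschitz constant times [a + b - s = - s']. *)
have sup := Wfun_superadd (ltW a0) (ltW b0).
have lip : Wfun (a + b) - Wfun s <= (expR A + 1) * (a + b - s).
  by apply: Wfun_lipschitz => //; lra.
rewrite (_ : a + b - s = - s') in lip; lra.
Qed.

(** Subtracting the two relations gives [(W s - s) + (W s' + s') = W a - a], so [s <= a] by
    monotonicity. The last bound comes from [W a - W s = W s' + r >= s'] and the Lipschitz
    estimate. *)
Lemma cancel_shock A a r s s' : 0 < a -> a <= A -> 0 < r -> 0 < s -> 0 < s' ->
    s - s' = a - r -> Wfun s + Wfun s' = Wfun a - r ->
  [/\ s <= a, s' <= r & s' <= (expR A + 1) * (a - s)].
Proof.
move=> a0 aA r0 s0 s'0 sE WE.
have ws' := Wfun_ge_id s'.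
have sa : s <= a.
  by rewrite leNgt; apply/negP => /ltW /Wfun_excess_le; lra.
split=> //; first lra.
have := Wfun_lipschitz (ltW s0) sa aA; lra.
Qed.

(** Here [W s = s], so the relations reduce to [W s' + s' = W a - a], which [s' > a] would
    contradict. *)
Lemma annihilate_shock a r s s' : 0 < a -> s <= 0 -> 0 < s' ->
    s - s' = a - r -> Wfun s + Wfun s' = Wfun a - r -> s' <= a.
Proof.
move=> a0 s0 s'0 sE; rewrite (WfunE_le0 s0) => WE.
by rewrite leNgt; apply/negP => /ltW /Wfun_excess_le; lra.
Qed.

(** When [s1] and [s2] have opposite signs, [|x|] alone is the sum of the strengths; when they have
    the same sign, [|y|] dominates this sum because [|W s| >= |s|]. *)
Lemma riemann_strength x y s1 s2 :
    x = s1 - s2 -> y = - (Wfun s1 + Wfun s2) -> `|s1| + `|s2| <= `|x| + `|y|.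
Proof.
move=> -> ->; have w1 := Wfun_ge_id s1; have w2 := Wfun_ge_id s2.
have n1 := ler_norm (s1 - s2); have n2 := ler_norm (- (s1 - s2)).
have n3 := ler_norm (Wfun s1 + Wfun s2).
have n4 := ler_norm (- (Wfun s1 + Wfun s2)).
rewrite normrN in n2; rewrite normrN in n4; rewrite normrN.
have p1 := normr_ge0 (s1 - s2); have p2 := normr_ge0 (Wfun s1 + Wfun s2).
have [a|/ltW a] := leP s1 0; have [b|/ltW b] := leP s2 0;
  rewrite ?(WfunE_le0 a) ?(WfunE_le0 b) ?(ler0_norm a) ?(ler0_norm b)
    ?(ger0_norm a) ?(ger0_norm b) in n3 n4 p2 *; lra.
Qed.

End wave_function.

(** * The potential, and the requirements on a single interaction *)

Section interaction_estimates.
Context {R : realType}.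
Variables (C0 C1 eps delta A Q : R).
Implicit Types (b : bool) (i : wfamily) (s x y D f : R).

(** Labels have a hysteresis: both are allowed between [eps / 2] and [eps]. Rarefactions are
    unconstrained. *)
Definition label_ok b s : Prop := 0 < s -> if b then eps / 2 <= s else s < eps.

(** Rarefactions get the neutral value, so that products can run over all fronts. *)
Definition shock_ratio i b s : R := if 0 < s then jump_ratio C0 C1 i b s else 1.

Definition deficit s : R := Num.max (eps - s) 0.

(* The total strength never increases, but may be conserved when shocks merge,
   which the extra weight [Q] on shocks detects. The deficit of the big shocks
   pays for the relabelings: being born with strength at least [eps] and lost
   below [eps / 2], a big shock is eroded by [eps / 2] in between. The [- 1]
   counts the big shocks. *)
Definition potential b s : R :=
  Q * (expR A + 1) * `|s| +
  if 0 < s then Q * s + (if b then 4 / eps * deficit s - 1 else 0) else 0.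

(* [f] is the factor by which the interaction multiplies the prefactor C1^L(t) Q(t)
   of the weight; the number [Q] of this section is another one. *)
Definition good_interaction i b1 s1 b2 s2 b s b' s' f : Prop :=
  [/\ label_ok b s /\ label_ok b' s', `|s| + `|s'| <= `|s1| + `|s2|,
      expR (- ((1 - ln C1) * (potential b1 s1 + potential b2 s2 -
                              potential b s - potential b' s'))) <= f,
      f <= 1
    & f * (shock_ratio i b s * shock_ratio (other i) b' s') <=
      shock_ratio i b1 s1 * shock_ratio i b2 s2].

Lemma good_interactionC i b1 s1 b2 s2 b s b' s' f :
  good_interaction i b1 s1 b2 s2 b s b' s' f ->
  good_interaction i b2 s2 b1 s1 b s b' s' f.
Proof.
case=> h1 h2 h3 h4 h5; split=> //; first by rewrite [leRHS]addrC.
  by rewrite (addrC (potential b2 s2)).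
by rewrite [leRHS]mulrC.
Qed.

Lemma shock_ratio_pos i b s : 0 < s -> shock_ratio i b s = jump_ratio C0 C1 i b s.
Proof. by rewrite /shock_ratio => ->. Qed.

Lemma shock_ratio_neg i b s : s <= 0 -> shock_ratio i b s = 1.
Proof. by rewrite /shock_ratio ltNge => ->. Qed.

Lemma label_ok_neg b s : s <= 0 -> label_ok b s.
Proof. by rewrite /label_ok ltNge => ->. Qed.

Lemma potential_pos b s : 0 < s -> potential b s =
  Q * (expR A + 1) * s + Q * s + if b then 4 / eps * deficit s - 1 else 0.
Proof. by rewrite /potential => s0; rewrite s0 gtr0_norm// addrA. Qed.

Lemma potential_neg b s : s <= 0 -> potential b s = - (Q * (expR A + 1) * s).
Proof. by move=> s0; rewrite /potential ltNge s0 ler0_norm// addr0 mulrN. Qed.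

Lemma deficit_ge0 s : 0 <= deficit s.
Proof. by rewrite /deficit le_max lexx orbT. Qed.

Lemma deficit_ge s : eps - s <= deficit s.
Proof. by rewrite /deficit le_max lexx. Qed.

Lemma deficit_le x y : x <= y -> deficit y <= deficit x.
Proof. by move=> xy; rewrite /deficit ge_max !le_max lexx orbT andbT lerB. Qed.

Lemma deficit_lip x y : x <= y -> deficit x - deficit y <= y - x.
Proof.
move=> xy; have := deficit_ge y; have := deficit_ge0 y => h1 h2.
by rewrite lerBlDr {1}/deficit ge_max; apply/andP; split; lra.
Qed.

Lemma deficit_big s : eps <= s -> deficit s = 0.
Proof. by move=> h; rewrite /deficit max_r// subr_le0. Qed.

(** For [x <= 1 / 2] one has [(1 - x)^-1 <= 1 + 2 * x <= expR (2 * x)]. *)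
Lemma expR_le_oneB x : 0 <= x -> x <= 1 / 2 -> expR (- (2 * x)) <= 1 - x.
Proof.
move=> x0 x1; rewrite expRN invf_ple ?posrE ?expR_gt0//; last lra.
apply: le_trans (expR_ge1Dx _); rewrite -[_^-1]mul1r ler_pdivrMr; nra.
Qed.

Lemma expR_le_invD x : 0 <= x -> expR (- x) <= (1 + x)^-1.
Proof. by move=> x0; rewrite expRN lef_pV2 ?posrE ?expR_gt0 ?expR_ge1Dx//; lra. Qed.

(** [A] is meant to bound the total strength of the waves. The cube of [eps / 2] in the condition on
    [Q] stems from the term [b * a ^+ 2] of [merge_shocks], for [a] and [b] at least [eps / 2]. *)
Record admissible : Prop := Admissible {
  adm_C0_gt0 : 0 < C0; adm_C0_lt : C0 < 1 / 2;
  adm_C1_gt0 : 0 < C1; adm_C1_le : C1 <= 1 / 4;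
  adm_eps_gt0 : 0 < eps; adm_eps_le : eps <= 1 / 2;
  adm_delta_gt0 : 0 < delta; adm_delta_lt : delta < eps / 2;
  adm_A_ge0 : 0 <= A;
  adm_Q_ge : 16 * (expR A + 2) <= Q * (eps / 2) ^+ 3 }.

(** As [eps / 2 <= 1 / 4], its cube is at most [1 / 64] and at most [eps / 2]; this gives the two
    bounds that involve [Q]. *)
Lemma admissible_bounds : admissible ->
  [/\ 1 <= expR A, ln C1 <= 0, 1024 * (expR A + 2) <= Q & 8 <= Q * eps].
Proof.
case=> _ _ C1_gt0 C1_le eps_gt0 eps_le _ _ A_ge0 Q_ge.
have expRA : 1 <= expR A by rewrite leNgt expR_lt1 -leNgt.
have eps2 : eps / 2 <= 1 / 4 by lra.
have eps2_ge0 : 0 <= eps / 2 by lra.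
have eps3_gt0 : 0 < (eps / 2) ^+ 3 by apply: exprn_gt0; lra.
have eps3 : (eps / 2) ^+ 3 <= (1 / 4) ^+ 3 by apply: lerXn2r => //; rewrite nnegrE; lra.
have sqr_le : 0 <= (eps / 2) ^+ 2 <= 1 by rewrite sqr_ge0 exprn_ile1//; lra.
have eps3_le : (eps / 2) ^+ 3 <= eps / 2 by rewrite exprS; nra.
split=> //; [by apply: ln_le0; lra|by nra|by nra].
Qed.

(** The rate [1 - ln C1] is at least [1] and at least [- ln C1]: a drop [D] of the potential pays
    for a factor [expR (- D)], and a drop of [1] pays for a factor [C1]. *)
Lemma expR_drop D : admissible -> 0 <= D ->
  expR (- ((1 - ln C1) * D)) <= expR (- D).
Proof. by move=> /admissible_bounds[_ C1_le _ _] D0; rewrite ler_expR; nra. Qed.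

Lemma expR_drop_le1 D : admissible -> 0 <= D -> expR (- ((1 - ln C1) * D)) <= 1.
Proof.
by move=> adm D0; apply: le_trans (expR_drop adm D0) _; rewrite expR_le1 oppr_le0.
Qed.

Lemma expR_drop_C1 D : admissible -> 1 <= D ->
  expR (- ((1 - ln C1) * D)) <= C1.
Proof.
move=> adm D1; have [_ C1_le _ _] := admissible_bounds adm.
by rewrite -[leRHS]lnK ?posrE ?(adm_C1_gt0 adm)// ler_expR; nra.
Qed.

Lemma expR_drop_le D D' f : admissible -> 0 <= D' -> D' <= D ->
  expR (- D') <= f -> expR (- ((1 - ln C1) * D)) <= f.
Proof.
move=> adm D0 DD; apply: le_trans; apply: le_trans (expR_drop adm (le_trans D0 DD)) _.
by rewrite ler_expR lerN2.
Qed.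


(** Up to a constant, the rarefaction [s'] is bounded below by [b * a ^+ 2]. Since [a >= eps / 2],
    the size of [Q] turns this into a multiple of [b], and into a fixed amount when [b >= eps / 2]
    as well. *)
Lemma merge_gain (a b s s' : R) : admissible -> eps / 2 <= a -> 0 < b -> a + b <= A ->
    0 < s -> s' < 0 -> s - s' = a + b -> Wfun s + Wfun s' = Wfun a + Wfun b ->
  [/\ a <= s, b <= s, 2 * b <= Q * - s' & eps / 2 <= b -> 2 <= Q * - s'].
Proof.
move=> adm a_ge b0 abA s0 s'0 sE WE.
have [expRA _ Q_ge _] := admissible_bounds adm.
case: adm => _ _ _ _ eps_gt0 eps_le _ _ A_ge0 Q_large.
have a0 : 0 < a by lra.
have [sa sb bnd] := merge_shocks a0 b0 s'0 abA sE WE.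
have e2_gt0 : 0 < (eps / 2) ^+ 2 by apply: exprn_gt0; lra.
have e2a : (eps / 2) ^+ 2 <= a ^+ 2 by apply: lerXn2r => //; rewrite nnegrE; lra.
have e3E : (eps / 2) ^+ 3 = eps / 2 * (eps / 2) ^+ 2 by rewrite exprS.
move: e2_gt0 e2a e3E Q_large bnd.
set E := expR A in expRA Q_ge *; set e2 := _ ^+ 2; set e3 := _ ^+ 3.
move=> e2_gt0 e2a e3E Q_large bnd.
have bnd' : Q * (b * e2) <= Q * (8 * (E + 2) * - s').
  by apply: ler_wpM2l; [lra|nra].
have Q_gt0 : 0 < Q by lra.
have E2 : 0 < 8 * (E + 2) by lra.
have Qe2_gt0 : 0 < Q * e2 by apply: mulr_gt0.
have Qe2 : 16 * (E + 2) <= Q * e2 by rewrite e3E in Q_large; nra.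
split=> // [|b_ge]; rewrite -(ler_pM2l E2).
- have := ler_wpM2l (ltW b0) Qe2; lra.
- have := ler_wpM2r (ltW Qe2_gt0) b_ge; rewrite e3E in Q_large; lra.
Qed.

Lemma good_big_big i (a b s : R) b' s' : admissible -> eps / 2 <= a -> eps / 2 <= b ->
    a + b <= A -> 0 < s -> s' < 0 ->
    s - s' = a + b -> Wfun s + Wfun s' = Wfun a + Wfun b ->
  good_interaction i true a true b true s b' s' (if i is F1 then C1 else 1).
Proof.
move=> adm a_ge b_ge abA s0 s'0 sE WE.
have [expRA _ Q_ge Qeps] := admissible_bounds adm.
have [C0_gt0 C0_lt C1_gt0 C1_le eps_gt0 eps_le _ _ _ _] := adm.
have a0 : 0 < a by lra.
have b0 : 0 < b by lra.
have [sa sb _ /(_ b_ge) gain] := merge_gain adm a_ge b0 abA s0 s'0 sE WE.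
have N_gt0 : 0 < 4 / eps by apply: divr_gt0; lra.
(* The total strength is conserved and the total deficit does not grow. Losing one big shock raises
   the potential by [1], while turning the amount [- s'] of shock strength into a rarefaction lowers
   it by [Q * - s' >= 2]. *)
have drop : 1 <= potential true a + potential true b - potential true s - potential b' s'.
  rewrite (potential_pos _ a0) (potential_pos _ b0) (potential_pos _ s0).
  rewrite (potential_neg _ (ltW s'0)).
  have := mulr_ge0 (ltW N_gt0) (deficit_ge0 a).
  have := ler_wpM2l (ltW N_gt0) (deficit_le sb).
  have -> : s = a + b + s' by lra.
  by nra.
split.
- by split=> [_|]; [lra|exact: label_ok_neg (ltW s'0)].
- by rewrite (gtr0_norm a0) (gtr0_norm b0) (gtr0_norm s0) (ltr0_norm s'0); lra.
- case: i; first exact: expR_drop_C1.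
  by apply: expR_drop_le1 => //; lra.
- by case: i => /=; lra.
- rewrite (shock_ratio_pos _ _ a0) (shock_ratio_pos _ _ b0).
  rewrite (shock_ratio_pos _ _ s0) (shock_ratio_neg _ _ (ltW s'0)).
  case: i => /=; first by rewrite mulr1.
  rewrite mul1r mulr1 ler_pMl ?invr_gt0// invf_ge1//; lra.
Qed.

End interaction_estimates.

(** * The remaining interactions within one family *)

Section interaction_cases.
Context {R : realType}.
Variables (C0 C1 eps delta A Q : R).
Implicit Types (l : bool) (i : wfamily) (a b s x y D f : R).
Local Notation admissible := (admissible C0 C1 eps delta A Q).
Local Notation potential := (potential eps A Q).
Local Notation shock_ratio := (shock_ratio C0 C1).
Local Notation good_interaction := (good_interaction C0 C1 eps A Q).

Lemma good_big_small i a b s l s' : admissible -> eps / 2 <= a -> 0 < b -> b < eps ->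
    a + b <= A -> 0 < s -> s' < 0 ->
    s - s' = a + b -> Wfun s + Wfun s' = Wfun a + Wfun b ->
  good_interaction i true a false b true s l s' (if i is F1 then 1 - C0 * b else 1).
Proof.
move=> adm a_ge b0 b_lt abA s0 s'0 sE WE.
have [expRA _ Q_ge Qeps] := admissible_bounds adm.
have [C0_gt0 C0_lt C1_gt0 C1_le eps_gt0 eps_le _ _ _ _] := adm.
have a0 : 0 < a by lra.
have [sa sb gain _] := merge_gain adm a_ge b0 abA s0 s'0 sE WE.
have N_gt0 : 0 < 4 / eps by apply: divr_gt0; lra.
(* The number of big shocks is unchanged, so the whole gain [Q * - s' >= 2 * b] remains. *)
have drop : 2 * b <= potential true a + potential false b - potential true s - potential l s'.
  rewrite (potential_pos _ _ _ _ a0) (potential_pos _ _ _ _ b0) (potential_pos _ _ _ _ s0).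
  rewrite (potential_neg _ _ _ _ (ltW s'0)).
  have := ler_wpM2l (ltW N_gt0) (deficit_le eps sa).
  have -> : s = a + b + s' by lra.
  by nra.
have b_le : 0 <= C0 * b <= 1 / 2 by apply/andP; split; nra.
split.
- by split=> [_|]; [lra|exact: label_ok_neg (ltW s'0)].
- by rewrite (gtr0_norm a0) (gtr0_norm b0) (gtr0_norm s0) (ltr0_norm s'0); lra.
- apply: (expR_drop_le adm _ drop); first lra.
  have : expR (- (2 * b)) <= expR (- (2 * (C0 * b))) by rewrite ler_expR; nra.
  case: i => [|_]; last by rewrite expR_le1; lra.
  by move/le_trans; apply; apply: expR_le_oneB; lra.
- by case: i => /=; lra.
- rewrite (shock_ratio_pos _ _ _ _ a0) (shock_ratio_pos _ _ _ _ b0).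
  rewrite (shock_ratio_pos _ _ _ _ s0) (shock_ratio_neg _ _ _ _ (ltW s'0)).
  case: i => /=; first lra.
  by rewrite mul1r mulr1 ler_peMr ?invr_ge0; lra.
Qed.

Lemma good_small_small i a b l s l' s' : admissible -> 0 < a -> a < eps ->
    0 < b -> b < eps -> a + b <= A -> 0 < s -> s' < 0 ->
    (if l then eps <= s else s < eps) ->
    s - s' = a + b -> Wfun s + Wfun s' = Wfun a + Wfun b ->
  good_interaction i false a false b l s l' s'
    (match i, l with
     | F1, false => Num.min ((1 - C0 * a) * (1 - C0 * b) / (1 - C0 * s)) 1
     | F2, true => C1
     | _, _ => 1
     end).
Proof.
move=> adm a0 a_lt b0 b_lt abA s0 s'0 s_lbl sE WE.
have [expRA _ Q_ge Qeps] := admissible_bounds adm.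
have [C0_gt0 C0_lt C1_gt0 C1_le eps_gt0 eps_le _ _ _ _] := adm.
have [sa sb _] := merge_shocks a0 b0 s'0 abA sE WE.
(* A newborn big shock has no deficit because [s >= eps], so its [- 1] alone is a drop of [1].
   Otherwise only [Q * - s'] is gained, which is enough because the factor is then at least
   [1 - 2 * C0 * - s']. *)
have drop : (if l then 1 else 2 * - s') <=
    potential false a + potential false b - potential l s - potential l' s'.
  rewrite (potential_pos _ _ _ _ a0) (potential_pos _ _ _ _ b0) (potential_pos _ _ _ _ s0).
  rewrite (potential_neg _ _ _ _ (ltW s'0)).
  have Qs : 2 * - s' <= Q * - s' by apply: ler_wpM2r; lra.
  have sE' : s = a + b + s' by lra.
  by case: l s_lbl => s_lbl; rewrite ?(deficit_big s_lbl) sE'; nra.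
split.
- by split=> [_|]; [case: l s_lbl {drop} => /= ?; lra|exact: label_ok_neg (ltW s'0)].
- by rewrite (gtr0_norm a0) (gtr0_norm b0) (gtr0_norm s0) (ltr0_norm s'0); lra.
- case: l s_lbl drop => /= s_lbl drop.
    by case: i => /=; [apply: (expR_drop_le1 adm); lra|exact: (expR_drop_C1 adm)].
  case: i; last by apply: (expR_drop_le1 adm); lra.
  apply: (expR_drop_le adm _ drop); first lra.
  rewrite le_min expR_le1 andbC; apply/andP; split; first lra.
  have : expR (- (2 * - s')) <= expR (- (2 * (2 * C0 * - s'))).
    by rewrite ler_expR; nra.
  move/le_trans; apply; apply: le_trans (expR_le_oneB _ _) _; [nra|nra|].
  have s'E : s' = s - a - b by lra.
  have s_lt : 2 * C0 * s <= 1 by nra.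
  rewrite ler_pdivlMr; last by nra.
  (* After clearing the denominator, the difference of the two sides is the sum of the next two
     nonnegative products. *)
  have : 0 <= C0 * - s' * (1 - 2 * C0 * s) by apply: mulr_ge0; [nra|lra].
  have : 0 <= (C0 * a) * (C0 * b) by apply: mulr_ge0; apply: mulr_ge0; lra.
  by rewrite s'E; lra.
- case: i; case: l {drop s_lbl} => /=; rewrite ?ge_min ?lexx ?orbT//; lra.
- rewrite (shock_ratio_pos _ _ _ _ a0) (shock_ratio_pos _ _ _ _ b0).
  rewrite (shock_ratio_pos _ _ _ _ s0) (shock_ratio_neg _ _ _ _ (ltW s'0)) mulr1.
  have [Ca Cb] : C0 * a <= 1 / 4 /\ C0 * b <= 1 / 4 by split; nra.
  have [Ca0 Cb0] : 0 <= C0 * a /\ 0 <= C0 * b by split; nra.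
  case: i; case: l {drop} s_lbl => /= s_lbl; rewrite ?mul1r.
  + by nra.
  + have Cs : 0 < 1 - C0 * s by nra.
    rewrite -ler_pdivlMr//; by rewrite ge_min lexx.
  + by rewrite divff ?gt_eqF//; nra.
  + by have : C0 * s <= C0 * (a + b) by [apply: ler_wpM2l; lra]; nra.
Qed.

(** The total strength drops by exactly [2 * (a - s)]. Half of this pays for the new shock [s'], the
    other half for the growth of the deficit, and the eroded shock strength leaves [Q * (a - s)].
    The loss of the label big is treated apart. *)
Lemma cancel_gain l a (r : R) l1 s s' : admissible -> 0 < a -> a <= A ->
    r < 0 -> 0 < s -> 0 < s' ->
    (if l then l1 = (eps / 2 <= s) else l1 = false) ->
    s - s' = a + r -> Wfun s + Wfun s' = Wfun a + Wfun r ->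
  [/\ s <= a, s' <= - r, s' <= (expR A + 1) * (a - s)
    & (if l && ~~ l1 then 1 else Q * (a - s)) <=
      potential l a + potential false r - potential l1 s - potential false s'].
Proof.
move=> adm a0 aA r0 s0 s'0 l1E sE WE.
have [expRA _ Q_ge Qeps] := admissible_bounds adm.
have [_ _ _ _ eps_gt0 _ _ _ _ _] := adm.
rewrite (WfunE_le0 (ltW r0)) in WE.
have r'0 : 0 < - r by lra.
have [|//|sa s'r s'le] := cancel_shock a0 aA r'0 s0 s'0; [lra|lra|].
split=> //.
rewrite (potential_pos _ _ _ _ a0) (potential_neg _ _ _ _ (ltW r0)).
rewrite (potential_pos _ _ _ _ s0) (potential_pos _ _ _ _ s'0).
have {sE WE} -> : r = s - s' - a by lra.
have d0 : 0 <= a - s by lra.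
have Q0 : 0 <= Q by lra.
have N_gt0 : 0 < 4 / eps by apply: divr_gt0; lra.
have N_le : 4 / eps <= Q by rewrite ler_pdivrMr//; lra.
have QE : Q <= Q * (expR A + 1) by rewrite ler_peMr; lra.
have Qs' := ler_wpM2l Q0 s'le; rewrite mulrA in Qs'.
have Nd := ler_wpM2r d0 N_le.
have Kd := ler_wpM2r d0 QE.
have Qd := mulr_ge0 Q0 d0.
have lip := ler_wpM2l (ltW N_gt0) (deficit_lip eps sa).
have ge := ler_wpM2l (ltW N_gt0) (deficit_ge eps a).
have NepsE : 4 / eps * eps = 4 by field; rewrite gt_eqF.
move: N_gt0 Qs' Nd Kd Qd lip ge NepsE; clear - l1E.
set K := Q * (expR A + 1); set N := 4 / eps => N_gt0 *.
case: l l1E => /= [l1E|-> /=]; last lra.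
case: l1 l1E => /= /esym l1E; first lra.
(* The deficit before was at least [eps - a] and the erosion supplies [N * (a - s)], in all
   [N * (eps - s) >= 4 - 2]; the loss of a big shock costs [1], so [1] remains. *)
have s_lt : s <= eps / 2 by rewrite leNgt; apply/negP => /ltW; rewrite l1E.
have := ler_wpM2l (ltW N_gt0) s_lt; lra.
Qed.

(** To be applied with [z], [x], [y] equal to [C0] times the strengths of the incoming shock, of the
    outgoing one and of the new shock of the other family; the quotient is then the number added to
    K in type 5A. *)
Lemma small_shock_ratio x y z : 0 <= x -> x <= z -> z <= 1 / 4 -> 0 <= y ->
  [/\ 1 - 2 * (z - x) <= (1 - z) / (1 - x),
      (1 - z) / ((1 - x) * (1 + y)) <= 1
    & (1 - z) / ((1 - x) * (1 + y)) * ((1 - x) * (1 + y)) = 1 - z].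
Proof.
move=> x0 xz z_le y0; have x1 : 0 < 1 - x by lra.
have xy : 0 < (1 - x) * (1 + y) by apply: mulr_gt0; lra.
split; last by rewrite divfK// gt_eqF.
- rewrite ler_pdivlMr//.
  have : 0 <= (z - x) * (1 - 2 * x) by apply: mulr_ge0; lra.
  lra.
- rewrite ler_pdivrMr// mul1r.
  have : 0 <= (1 - x) * y by apply: mulr_ge0; lra.
  lra.
Qed.

Lemma good_shock_rar i l a (r : R) l1 s s' : admissible -> 0 < a ->
    (if l then eps / 2 <= a else a < eps) ->
    - delta <= r -> r < 0 -> a + - r <= A -> 0 < s -> 0 < s' ->
    (if l then l1 = (eps / 2 <= s) else l1 = false) ->
    s - s' = a + r -> Wfun s + Wfun s' = Wfun a + Wfun r ->
  good_interaction i l a false r l1 s false s'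
    (match i, l, l1 with
     | F1, true, true => 1 / (1 + C0 * s')
     | F1, true, false => C1
     | F1, false, _ => (1 - C0 * a) / ((1 - C0 * s) * (1 + C0 * s'))
     | F2, _, _ => 1
     end).
Proof.
move=> adm a0 a_lbl r_ge r0 arA s0 s'0 l1E sE WE.
have aA : a <= A by lra.
have [sa s'r s'le drop] := cancel_gain adm a0 aA r0 s0 s'0 l1E sE WE.
have [expRA _ Q_ge _] := admissible_bounds adm.
have [C0_gt0 C0_lt C1_gt0 C1_le eps_gt0 eps_le _ delta_lt _ _] := adm.
clear WE aA arA.
have C0_ge0 := ltW C0_gt0.
have Csa : C0 * s <= C0 * a by rewrite ler_wpM2l.
have Cs0 : 0 <= C0 * s by rewrite mulr_ge0 ?(ltW s0).
have Cs'0 : 0 <= C0 * s' by rewrite mulr_ge0 ?(ltW s'0).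
have Cs'_le : C0 * s' <= 1 / 2 * s' by rewrite ler_wpM2r ?(ltW s'0) ?(ltW C0_lt).
have d0 : 0 <= a - s by rewrite subr_ge0.
have Q0 : 0 <= Q by lra.
split.
- split=> [_|_]; last lra.
  case: l a_lbl l1E {drop} => /= a_lbl -> /=; last lra.
  by case: (leP (eps / 2) s) => // ?; lra.
- by rewrite (gtr0_norm a0) (ltr0_norm r0) (gtr0_norm s0) (gtr0_norm s'0); lra.
- have Qd := mulr_ge0 Q0 d0.
  case: i; last by apply: (expR_drop_le1 adm); case: ifP drop => _; lra.
  (* Where the drop is [Q * (a - s)], it exceeds the multiples of [a - s] and of
     [s' <= (expR A + 1) * (a - s)] needed below. *)
  have Qd' := ler_wpM2r d0 Q_ge.
  have Ed : 1 * (a - s) <= expR A * (a - s) by apply: ler_wpM2r.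
  have Cd : C0 * (a - s) <= 1 / 2 * (a - s) by rewrite ler_wpM2r ?(ltW C0_lt).
  move: Qd Qd' Ed Cd; clear expRA Q_ge Q0 r_ge r0 sE s'r eps_gt0 delta_lt.
  case: l a_lbl l1E drop => /= a_lbl l1E drop Qd Qd' Ed Cd.
    case: l1 l1E drop => /= l1E drop; last exact: (expR_drop_C1 adm).
    apply: (expR_drop_le adm _ drop); first lra.
    apply: le_trans (_ : expR (- (C0 * s')) <= _); first by rewrite ler_expR; lra.
    by rewrite div1r; exact: expR_le_invD.
  have Ca : C0 * a <= 1 / 4 by nra.
  have [le_ratio _ _] := small_shock_ratio Cs0 Csa Ca Cs'0.
  apply: (expR_drop_le adm _ drop); first lra.
  apply: le_trans (_ : expR (- (2 * (2 * (C0 * a - C0 * s)))) * expR (- (C0 * s')) <= _).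
    by rewrite -expRD ler_expR; lra.
  rewrite invfM [leRHS]mulrA; apply: ler_pM; rewrite ?expR_ge0//; last exact: expR_le_invD.
  by apply: le_trans (expR_le_oneB _ _) le_ratio; lra.
- case: i => //; case: l a_lbl l1E {drop} => /= a_lbl l1E.
    have C1_le1 : C1 <= 1 by lra.
    by case: l1 l1E => _ //; rewrite div1r invf_le1 ?lerDl// ltr_wpDr.
  have Ca : C0 * a <= 1 / 4 by nra.
  by have [] := small_shock_ratio Cs0 Csa Ca Cs'0.
- rewrite (shock_ratio_pos _ _ _ _ a0) (shock_ratio_neg _ _ _ _ (ltW r0)).
  rewrite (shock_ratio_pos _ _ _ _ s0) (shock_ratio_pos _ _ _ _ s'0) mulr1.
  have Css' : 0 <= C0 * s * (C0 * s') by exact: mulr_ge0.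
  clear expRA Q_ge Q0 drop s'le d0.
  have C1V : 4 <= C1^-1 by rewrite -[4]invrK lef_pV2 ?posrE ?invr_gt0// -div1r.
  case: l a_lbl l1E => /= a_lbl l1E; last first.
    have Ca : C0 * a <= 1 / 4 by nra.
    have [_ _ ratioE] := small_shock_ratio Cs0 Csa Ca Cs'0.
    by rewrite l1E; case: i => /=; [rewrite ratioE|lra].
  case: l1 l1E => /= /esym l1E.
    case: i => /=; last by rewrite mul1r ger_pMr ?invr_gt0//; lra.
    by rewrite div1r mulrCA mulVf ?mulr1// gt_eqF// ltr_wpDr.
  have s_lt : s < eps / 2 by rewrite ltNge l1E.
  (* Rarefaction fronts are weaker than [eps / 2 <= a], so [s - s' = a + r] is positive. *)
  have Cs's : C0 * s' <= C0 * s by rewrite ler_wpM2l//; lra.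
  have Cs : C0 * s <= 1 / 2 * s by rewrite ler_wpM2r ?(ltW s0) ?(ltW C0_lt).
  by case: i => /=; [rewrite ger_pMr//; lra|lra].
Qed.

(** The total strength drops by exactly [2 * a], and [s' <= a] keeps the term in the shock strength
    from growing; the drop then controls both parts of [(1 - C0 * a) / (1 + C0 * s')]. *)
Lemma good_annihilation i a (r : R) l1 s s' : admissible -> 0 < a -> a < eps ->
    r < 0 -> s <= 0 -> 0 < s' ->
    s - s' = a + r -> Wfun s + Wfun s' = Wfun a + Wfun r ->
  good_interaction i false a false r l1 s false s'
    (if i is F1 then (1 - C0 * a) / (1 + C0 * s') else 1).
Proof.
move=> adm a0 a_lt r0 s0 s'0 sE WE.
have [expRA _ Q_ge Qeps] := admissible_bounds adm.
have [C0_gt0 C0_lt C1_gt0 C1_le eps_gt0 eps_le _ _ _ _] := adm.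
rewrite (WfunE_le0 (ltW r0)) in WE.
have s'a : s' <= a by apply: (annihilate_shock a0 s0 s'0 (r := - r)); lra.
have QE : Q <= Q * (expR A + 1) by nra.
have drop : 2 * a <=
    potential false a + potential false r - potential l1 s - potential false s'.
  rewrite (potential_pos _ _ _ _ a0) (potential_neg _ _ _ _ (ltW r0)).
  rewrite (potential_neg _ _ _ _ s0) (potential_pos _ _ _ _ s'0).
  have rE : r = s - s' - a by lra.
  have Qs' : Q * s' <= Q * a by apply: ler_wpM2l; lra.
  have Qa : 1 * a <= Q * (expR A + 1) * a by rewrite ler_wpM2r ?(ltW a0)//; lra.
  rewrite rE; lra.
have [Ca Cs'] : C0 * a <= 1 / 4 /\ C0 * s' <= a / 2 by split; nra.
have [Ca0 Cs0] : 0 <= C0 * a /\ 0 <= C0 * s' by split; nra.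
split.
- by split; [exact: label_ok_neg|move=> _; lra].
- by rewrite (gtr0_norm a0) (ltr0_norm r0) (ler0_norm s0) (gtr0_norm s'0); lra.
- case: i; last by apply: (expR_drop_le1 adm); lra.
  apply: (expR_drop_le adm _ drop); first lra.
  apply: le_trans (_ : expR (- (2 * (C0 * a))) * expR (- (C0 * s')) <= _).
    by rewrite -expRD ler_expR; nra.
  by apply: ler_pM; rewrite ?expR_ge0//; [apply: expR_le_oneB; lra|exact: expR_le_invD].
- by case: i => //; rewrite ler_pdivrMr; lra.
- rewrite (shock_ratio_pos _ _ _ _ a0) (shock_ratio_neg _ _ _ _ (ltW r0)).
  rewrite (shock_ratio_neg _ _ _ _ s0) (shock_ratio_pos _ _ _ _ s'0) mulr1 mul1r.
  by case: i => /=; [rewrite divfK// gt_eqF; lra|lra].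
Qed.

End interaction_cases.

(** * Events, with their labels and factors *)

Section events.
Context {R : realType}.
Variables (C0 C1 eps delta A Q : R).
Implicit Types (i : wfamily) (u : R * R) (f : front R) (e : event R).
Local Notation admissible := (admissible C0 C1 eps delta A Q).
Local Notation potential := (potential eps A Q).
Local Notation shock_ratio := (shock_ratio C0 C1).

Definition event_factor e : R :=
  C1 ^+ counted_in_L (etype e) * \prod_(k <- added_to_K C0 e) k.

(** In these coordinates every wave is a translation, even where [tau] is not known to be positive;
    states of fronts are therefore compared through [coords]. *)
Definition coords u : R * R := (wcoord u, u.2).

Lemma coords_Tw i (s : R) u :
  coords (Tw i s u) = (wcoord u + wave_sign R i * s, u.2 - Wfun s).
Proof. by rewrite /coords /Tw /of_wv /= {1}/wcoord /= expRK opprK. Qed.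

(** [front_rar] normalizes the label of rarefactions to the value [false] that the estimates give
    them; [front_fine] is a condition on rarefaction fronts only, since [delta] is positive. *)
Record front_ok f : Prop := FrontOk {
  front_coords : coords (rst f) = coords (Tw (fam f) (str f) (lst f));
  front_label : label_ok eps (big f) (str f);
  front_rar : str f <= 0 -> big f = false;
  front_fine : - delta <= str f }.

Definition front_potential f : R := potential (big f) (str f).
Definition front_ratio f : R := shock_ratio (fam f) (big f) (str f).

Lemma is_bigP f : is_big f -> 0 < str f /\ big f = true.
Proof. by case/andP => ? ->. Qed.

Lemma is_smallP f : is_small f -> 0 < str f /\ big f = false.
Proof. by case/andP => ? /negbTE ->. Qed.

Lemma is_small_strE e : is_small (einl e) -> small_str e = str (einl e).
Proof. by rewrite /small_str => ->. Qed.

Lemma not_small_strE e : is_big (einl e) || is_rar (einl e) -> small_str e = str (einr e).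
Proof.
rewrite /small_str /is_small; case/orP => [/is_bigP[_ ->]|]; first by rewrite andbF.
by rewrite /is_rar /is_shock => /ltW; rewrite leNgt => /negbTE ->.
Qed.

(** Each type is matched with one of the estimates above; when the incoming waves are of different
    kinds, [good_interactionC] reduces one left-right order to the other. *)
Lemma same_family_good i c e : admissible -> same_rule eps i c e ->
    etype e = Same i c ->
    front_ok (einl e) -> front_ok (einr e) ->
    `|str (einl e)| + `|str (einr e)| <= A ->
    eout e i - eout e (other i) = str (einl e) + str (einr e) ->
    Wfun (eout e i) + Wfun (eout e (other i)) =
      Wfun (str (einl e)) + Wfun (str (einr e)) ->
  good_interaction C0 C1 eps A Q i (big (einl e)) (str (einl e))
    (big (einr e)) (str (einr e)) (elab e i) (eout e i)
    (elab e (other i)) (eout e (other i)) (event_factor e).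
Proof.
move=> adm rule tyE [_ lblL rarL finL] [_ lblR rarR finR] bnd sE WE.
have sizeE b l b' l' : 0 < l -> 0 < l' -> `|l| + `|l'| <= A -> label_ok eps b l ->
    label_ok eps b' l' -> [/\ l + l' <= A, if b then eps / 2 <= l else l < eps
                            & if b' then eps / 2 <= l' else l' < eps].
  by move=> l0 l'0; rewrite (gtr0_norm l0) (gtr0_norm l'0) => ? /(_ l0) ? /(_ l'0) ?.
have sizeN l l' : 0 < l -> l' < 0 -> `|l| + `|l'| <= A -> l + - l' <= A.
  by move=> l0 l'0; rewrite (gtr0_norm l0) (ltr0_norm l'0).
move: bnd lblL rarL finL lblR rarR finR sE WE.
rewrite /event_factor /added_to_K tyE.
case: c rule {tyE} => /= [] [].
- move=> H s0 bE s'0.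
  have {H} [/is_bigP[l0 ->] /is_bigP[r0 ->]] : is_big (einl e) /\ is_big (einr e).
    by case/orP: H => /andP[].
  move=> bnd lblL _ _ lblR _ _ sE WE.
  have [bnd' lL lR] := sizeE _ _ _ _ l0 r0 bnd lblL lblR.
  have := good_big_big i (elab e (other i)) adm lL lR bnd' s0 s'0 sE WE; rewrite bE.
  by case: i {sE WE s0 s'0 bE} => /=; rewrite big_nil mulr1.
- move=> /orP[] /andP[]; [move=> B S|move=> S B]; move: B S (B) (S);
    move=> /is_bigP[l0 lE] /is_smallP[r0 rE] B S s0 bE s'0;
    move=> bnd lblL _ _ lblR _ _ sE WE.
  + have [bnd' lL lR] := sizeE _ _ _ _ l0 r0 bnd lblL lblR.
    move: lL lR; rewrite lE rE bE => lL lR.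
    have := good_big_small i (elab e (other i)) adm lL r0 lR bnd' s0 s'0 sE WE.
    rewrite not_small_strE ?B//.
    by case: i {sE WE s0 s'0 bE} => /=; rewrite ?big_nil ?big_seq1 ?mul1r ?mulr1.
  + rewrite addrC in bnd; rewrite (addrC (str (einl e))) in sE.
    rewrite (addrC (Wfun (str (einl e)))) in WE.
    have [bnd' lR lL] := sizeE _ _ _ _ l0 r0 bnd lblR lblL.
    move: lL lR; rewrite lE rE bE => lL lR; apply: good_interactionC.
    have := good_big_small i (elab e (other i)) adm lR r0 lL bnd' s0 s'0 sE WE.
    rewrite is_small_strE//.
    by case: i {sE WE s0 s'0 bE} => /=; rewrite ?big_nil ?big_seq1 ?mul1r ?mulr1.
- move=> /orP[] /andP[]; [move=> B r0|move=> r0 B]; move: B;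
    move=> /is_bigP[l0 lE] s0 s_ge bE [s'0 /negbTE b'E].
  + move=> bnd lblL _ _ _ rarR finR sE WE; have bnd' := sizeN _ _ l0 r0 bnd.
    have := lblL l0; rewrite lE (rarR (ltW r0)) b'E => lL.
    have := @good_shock_rar _ _ _ _ _ _ _ i true _ _ true _ _ adm l0 lL finR
      r0 bnd' s0 s'0 (esym s_ge) sE WE.
    rewrite bE.
    by case: i {sE WE s0 s_ge s'0 bE b'E} => /=; rewrite ?big_nil ?big_seq1 ?mul1r ?mulr1.
  + rewrite addrC => bnd _ rarR finR lblL _ _; have bnd' := sizeN _ _ l0 r0 bnd.
    rewrite (addrC (str (einl e))) (addrC (Wfun (str (einl e)))) => sE WE.
    have := lblL l0; rewrite lE (rarR (ltW r0)) b'E => lL; apply: good_interactionC.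
    have := @good_shock_rar _ _ _ _ _ _ _ i true _ _ true _ _ adm l0 lL finR
      r0 bnd' s0 s'0 (esym s_ge) sE WE.
    rewrite bE.
    by case: i {sE WE s0 s_ge s'0 bE b'E} => /=; rewrite ?big_nil ?big_seq1 ?mul1r ?mulr1.
- move=> /orP[] /andP[]; [move=> B r0|move=> r0 B]; move: B;
    move=> /is_bigP[l0 lE] s0 s_lt /negbTE bE [s'0 /negbTE b'E].
  + move=> bnd lblL _ _ _ rarR finR sE WE; have bnd' := sizeN _ _ l0 r0 bnd.
    have := lblL l0; rewrite lE (rarR (ltW r0)) b'E => lL.
    have := @good_shock_rar _ _ _ _ _ _ _ i true _ _ false _ _ adm l0 lL finR
      r0 bnd' s0 s'0 (esym (lt_geF s_lt)) sE WE.
    rewrite bE.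
    by case: i {sE WE s0 s_lt s'0 bE b'E} => /=; rewrite ?big_nil ?big_seq1 ?mul1r ?mulr1.
  + rewrite addrC => bnd _ rarR finR lblL _ _; have bnd' := sizeN _ _ l0 r0 bnd.
    rewrite (addrC (str (einl e))) (addrC (Wfun (str (einl e)))) => sE WE.
    have := lblL l0; rewrite lE (rarR (ltW r0)) b'E => lL; apply: good_interactionC.
    have := @good_shock_rar _ _ _ _ _ _ _ i true _ _ false _ _ adm l0 lL finR
      r0 bnd' s0 s'0 (esym (lt_geF s_lt)) sE WE.
    rewrite bE.
    by case: i {sE WE s0 s_lt s'0 bE b'E} => /=; rewrite ?big_nil ?big_seq1 ?mul1r ?mulr1.
- move=> H s0 s_lt /negbTE bE s'0.
  have {H} [/is_smallP[l0 ->] /is_smallP[r0 ->]] : is_small (einl e) /\ is_small (einr e).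
    by case/orP: H => /andP[].
  move=> bnd lblL _ _ lblR _ _ sE WE.
  have [bnd' lL lR] := sizeE _ _ _ _ l0 r0 bnd lblL lblR.
  have := @good_small_small _ _ _ _ _ _ _ i _ _ false _ (elab e (other i)) _
    adm l0 lL r0 lR bnd' s0 s'0 s_lt sE WE.
  rewrite bE.
  by case: i {sE WE s0 s_lt s'0 bE} => /=; rewrite ?big_nil ?big_seq1 ?mul1r ?mulr1.
- move=> H s0 s_ge bE s'0.
  have {H} [/is_smallP[l0 ->] /is_smallP[r0 ->]] : is_small (einl e) /\ is_small (einr e).
    by case/orP: H => /andP[].
  move=> bnd lblL _ _ lblR _ _ sE WE.
  have [bnd' lL lR] := sizeE _ _ _ _ l0 r0 bnd lblL lblR.
  have := @good_small_small _ _ _ _ _ _ _ i _ _ true _ (elab e (other i)) _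
    adm l0 lL r0 lR bnd' s0 s'0 s_ge sE WE.
  rewrite bE.
  by case: i {sE WE s0 s_ge s'0 bE} => /=; rewrite ?big_nil ?big_seq1 ?mul1r ?mulr1.
- move=> /orP[] /andP[]; [move=> B r0|move=> r0 B]; move: B (B);
    move=> /is_smallP[l0 lE] B s0 /negbTE bE s'0 /negbTE b'E.
  + move=> bnd lblL _ _ _ rarR finR sE WE; have bnd' := sizeN _ _ l0 r0 bnd.
    have := lblL l0; rewrite lE (rarR (ltW r0)) b'E is_small_strE// => lL.
    have := @good_shock_rar _ _ _ _ _ _ _ i false _ _ false _ _ adm l0 lL finR
      r0 bnd' s0 s'0 erefl sE WE.
    rewrite bE.
    by case: i {sE WE s0 s'0 bE b'E} => /=; rewrite ?big_nil ?big_seq1 ?mul1r ?mulr1.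
  + rewrite addrC => bnd _ rarR finR lblL _ _; have bnd' := sizeN _ _ l0 r0 bnd.
    rewrite (addrC (str (einl e))) (addrC (Wfun (str (einl e)))) => sE WE.
    have := lblL l0; rewrite lE (rarR (ltW r0)) b'E not_small_strE ?r0 ?orbT//.
    move=> lL; apply: good_interactionC.
    have := @good_shock_rar _ _ _ _ _ _ _ i false _ _ false _ _ adm l0 lL finR
      r0 bnd' s0 s'0 erefl sE WE.
    rewrite bE.
    by case: i {sE WE s0 s'0 bE b'E} => /=; rewrite ?big_nil ?big_seq1 ?mul1r ?mulr1.
- move=> /orP[] /andP[]; [move=> B r0|move=> r0 B]; move: B (B);
    move=> /is_smallP[l0 lE] B s0 s'0 /negbTE b'E.
  + move=> bnd lblL _ _ _ rarR finR sE WE.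
    have := lblL l0; rewrite lE (rarR (ltW r0)) b'E is_small_strE// => lL.
    have := @good_annihilation _ _ _ _ _ _ _ i _ _ (elab e i) _ _ adm l0 lL r0 s0 s'0 sE WE.
    by case: i {sE WE s0 s'0 b'E} => /=; rewrite ?big_nil ?big_seq1 ?mul1r ?mulr1.
  + rewrite addrC => bnd _ rarR finR lblL _ _.
    rewrite (addrC (str (einl e))) (addrC (Wfun (str (einl e)))) => sE WE.
    have := lblL l0; rewrite lE (rarR (ltW r0)) b'E not_small_strE ?r0 ?orbT//.
    move=> lL; apply: good_interactionC.
    have := @good_annihilation _ _ _ _ _ _ _ i _ _ (elab e i) _ _ adm l0 lL r0 s0 s'0 sE WE.
    by case: i {sE WE s0 s'0 b'E} => /=; rewrite ?big_nil ?big_seq1 ?mul1r ?mulr1.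
Qed.

End events.

(** * Meetings of neighbouring fronts, and the output of the Riemann solver *)

Section solver.
Context {R : realType}.
Variables (C0 C1 eps delta A Q : R).
Implicit Types (i : wfamily) (u : R * R) (f : front R) (e : event R) (fs : seq (front R)).
Local Notation admissible := (admissible C0 C1 eps delta A Q).
Local Notation potential := (potential eps A Q).
Local Notation shock_ratio := (shock_ratio C0 C1).
Local Notation event_factor := (event_factor C0 C1).
Local Notation front_ok := (front_ok eps delta).
Local Notation front_potential := (front_potential eps A Q).
Local Notation front_ratio := (front_ratio C0 C1).

(** Reading the jump of [w] and of [v] between the outer states along the incoming and along the
    outgoing waves gives the two relations between strengths. In a trivial interaction potentials
    and ratios are merely exchanged. *)
Lemma event_good e : admissible -> event_rule eps e ->
    front_ok (einl e) -> front_ok (einr e) ->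
    coords (rst (einl e)) = coords (lst (einr e)) ->
    `|str (einl e)| + `|str (einr e)| <= A ->
    Tw F2 (eout e F2) (Tw F1 (eout e F1) (lst (einl e))) = rst (einr e) ->
  [/\ forall i, label_ok eps (elab e i) (eout e i),
      `|eout e F1| + `|eout e F2| <= `|str (einl e)| + `|str (einr e)|,
      expR (- ((1 - ln C1) *
        (front_potential (einl e) + front_potential (einr e) -
         (potential (elab e F1) (eout e F1) + potential (elab e F2) (eout e F2)))))
      <= event_factor e,
      event_factor e <= 1
    & event_factor e * (shock_ratio F1 (elab e F1) (eout e F1) *
                        shock_ratio F2 (elab e F2) (eout e F2)) <=
      front_ratio (einl e) * front_ratio (einr e)].
Proof.
move=> adm rule okl okr lr bnd outE; move: (okl) (okr) => [eql lbll _ _] [eqr lblr _ _].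
have {outE} : coords (rst (einr e)) =
    coords (Tw F2 (eout e F2) (Tw F1 (eout e F1) (lst (einl e)))).
  by rewrite outE.
rewrite eqr !coords_Tw /= [wcoord (Tw _ _ _)](congr1 fst (coords_Tw _ _ _)).
move: (eql); rewrite lr coords_Tw => -[wl vl]; rewrite wl vl /=.
move=> [wE vE].
move: rule; rewrite /event_rule; case tyE: (etype e) => [|i c].
- case=> fam_r oE oE' lE lE'.
  have factorE : event_factor e = 1.
    by rewrite /event_factor /added_to_K tyE /= expr0 mul1r big_nil.
  rewrite factorE /front_potential /front_ratio.
  move: fam_r oE oE' lE lE' => ->.
  case: (fam (einl e)) => /= oE oE' lE lE'; rewrite oE oE' lE lE'.
    split=> //; [by case; rewrite ?oE ?oE' ?lE ?lE'| |by rewrite mul1r].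
    by rewrite subrr mulr0 oppr0 expR0.
  split=> //; [by case; rewrite ?oE ?oE' ?lE ?lE'|by rewrite addrC| |by rewrite mul1r mulrC].
  by rewrite (addrC (potential (big (einl e)) _)) subrr mulr0 oppr0 expR0.
- case=> fam_l fam_r rule.
  have sE : eout e i - eout e (other i) = str (einl e) + str (einr e).
    by move: wE; rewrite fam_l fam_r /wave_sign; case: (i); rewrite /=; lra.
  have WE : Wfun (eout e i) + Wfun (eout e (other i)) =
      Wfun (str (einl e)) + Wfun (str (einr e)).
    by move: vE; case: (i); rewrite /=; lra.
  have [[lbl lbl'] sz ex le1 rat] := same_family_good adm rule tyE okl okr bnd sE WE.
  move: lbl lbl' sz ex rat; rewrite /front_potential /front_ratio fam_l fam_r.
  by case: (i) => /= lbl lbl' sz ex rat; split=> //;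
    [case|rewrite opprD addrA|case|rewrite addrC
    |rewrite (addrC (potential (elab e F1) _)) opprD addrA
    |rewrite (mulrC (shock_ratio F1 _ _))].
Qed.

Definition lipschitz_from (tb : R) (h : R -> R) : Prop :=
  exists M, forall s t, tb <= s -> s <= t -> `|h t - h s| <= M * (t - s).

Fixpoint chained (c : R * R) fs (c' : R * R) : Prop :=
  if fs is f :: fs' then coords (lst f) = c /\ chained (coords (rst f)) fs' c'
  else c = c'.

Lemma chained_cat c fs fs' c' :
  chained c (fs ++ fs') c' <-> exists2 m, chained c fs m & chained m fs' c'.
Proof.
elim: fs c => [|f fs IH] c /=; first by split=> [|[m ->]//]; exists c.
rewrite IH; split=> [[-> [m cm mc']]|[m [-> cm] mc']]; first by exists m.
by split=> //; exists m.
Qed.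

Lemma perturbed_lipschitz kap tb x y :
  perturbed kap tb x y -> lipschitz_from tb x -> lipschitz_from tb y.
Proof.
move=> [_ yx] [M xM]; exists (kap + M) => s t ts st.
have := yx s t ts st; have := xM s t ts st => h1 h2.
have -> : y t - y s = (y t - x t - (y s - x s)) + (x t - x s) by ring.
by rewrite mulrDl; apply: le_trans (ler_normD _ _) (lerD h2 h1).
Qed.

Lemma lipschitz_lipschitz_from tb (h : R -> R) :
  [lipschitz h t | t in `[tb, +oo[] -> lipschitz_from tb h.
Proof.
(* The Lipschitz bound is stated for all constants near [+oo]; one of them is picked. *)
move=> h_lip; have [M hM] := @filter_ex _ (pinfty_nbhs R) _ _ h_lip; exists M => s t ts st.
have /= := hM (t, s); rewrite /self_sub /= (ger0_norm (_ : 0 <= t - s)) ?subr_ge0//.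
by apply; split; rewrite /= in_itv /= andbT // (le_trans ts st).
Qed.

Record emitted (tb xb : R) f : Prop := Emitted {
  emitted_ok : front_ok f;
  emitted_lip : lipschitz_from tb (pos f);
  emitted_pos : pos f tb = xb }.

Record fan_summary (tb xb : R) (c c' : R * R) (size pot ratio : R) fs : Prop := FanSummary {
  fan_emitted : List.Forall (emitted tb xb) fs;
  fan_chained : chained c fs c';
  fan_size : \sum_(f <- fs) `|str f| = size;
  fan_potential : \sum_(f <- fs) front_potential f = pot;
  fan_ratio : \prod_(f <- fs) front_ratio f = ratio }.

Lemma fan_summary_cat tb xb c m c' n1 p1 r1 n2 p2 r2 fs1 fs2 :
  fan_summary tb xb c m n1 p1 r1 fs1 -> fan_summary tb xb m c' n2 p2 r2 fs2 ->
  fan_summary tb xb c c' (n1 + n2) (p1 + p2) (r1 * r2) (fs1 ++ fs2).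
Proof.
move=> [e1 c1 <- <- <-] [e2 c2 <- <- <-]; split; rewrite ?big_cat//.
  exact/List.Forall_app.
by apply/chained_cat; exists m.
Qed.

(** Cutting a rarefaction into [p] fronts changes neither the sums nor the product, as the potential
    is linear on [s <= 0] and the ratio is [1] there. A fan thus counts as the single wave it
    replaces. *)
Lemma wave_fan_summary (u : R * R -> R * R) lamhat kap i (s : R) b ul tb xb out :
  0 < delta -> label_ok eps b s ->
  wave_fan u C0 C1 lamhat delta kap i s b ul tb xb out ->
  fan_summary tb xb (coords ul) (coords (Tw i s ul)) `|s| (potential b s)
    (shock_ratio i b s) out.
Proof.
move=> delta_gt0 lbl; rewrite /wave_fan; case: ltgtP => [s0|s0|s0].
- set p := `|_|%N; pose st j := Tw i (j%:R * s / p%:R) ul.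
  pose fr y j := Front i (s / p%:R) false (st j.-1) (st j) (y j).
  move=> [y [y_pert ->]];
  (* Rounding up keeps each front within [delta] and makes [p] positive. *)
  have p_ge : `|s| / delta <= p%:R.
    apply: le_trans (ceil_ge _) _.
    rewrite -[p%:R]/(p%:Z%:~R) ler_int; exact: ler_norm.
  have p_gt0 : 0 < p%:R :> R.
    by apply: lt_le_trans p_ge; rewrite divr_gt0// normr_gt0 lt_eqF.
  have sp_lt0 : s / p%:R < 0 by rewrite pmulr_llt0 ?invr_gt0.
  have stE j : coords (st j) = (wcoord ul + wave_sign R i * (j%:R * (s / p%:R)),
                                ul.2 - j%:R * (s / p%:R)).
    by rewrite coords_Tw -[_ * s / _]mulrA WfunE_le0// mulr_ge0_le0// ltW.
  have st0 : coords (st 0%N) = coords ul.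
    by rewrite stE mul0r mulr0 addr0 subr0.
  have stp : coords (st p) = coords (Tw i s ul).
    by rewrite stE coords_Tw (WfunE_le0 (ltW s0)) [_ * (s / _)]mulrC divfK// gt_eqF.
  have iotaE : iota 1 p = index_iota 1 p.+1 by rewrite /index_iota subn1.
  have sumE (x : R) : \sum_(j <- iota 1 p) x = x * p%:R.
    by rewrite iotaE sumr_const_nat subn1 /= mulr_natr.
  split.
  (* The induction is over segments of the fan starting anywhere; the front numbered [m.+1] has left
     state [st m]. *)
  + suff H n m : List.Forall (emitted tb xb) (map (fr y) (iota m.+1 n)) by exact: H.
    elim: n m => [|n IH] m /=; first exact: List.Forall_nil.
    apply: List.Forall_cons; last exact: IH.
    split=> /=; last by rewrite (y_pert m.+1).1 subrr mul0r addr0.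
      split=> //=; last 1 first.
      * rewrite lerNl -mulNr -(ltr0_norm s0).
        by rewrite ler_pdivrMr// mulrC -ler_pdivrMr.
      * have wE : wcoord (st m) = _ := congr1 fst (stE m).
        have vE : (st m).2 = _ := congr1 snd (stE m).
        rewrite stE coords_Tw wE vE (WfunE_le0 (ltW sp_lt0)) -natr1 /=.
        by congr pair; ring.
      * exact: label_ok_neg (ltW sp_lt0).
    apply: perturbed_lipschitz (y_pert m.+1) _.
    exists `|lambda i (st m.+1)| => t t' _ tt'.
    rewrite opprD addrACA subrr add0r -mulrBl normrM mulrC.
    by rewrite ler_wpM2l// opprD addrACA subrr addr0 ger0_norm// subr_ge0.
  + rewrite -st0 -stp.
    suff H n m : chained (coords (st m)) (map (fr y) (iota m.+1 n)) (coords (st (m + n)%N)).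
      exact: H p 0%N.
    elim: n m => [|n IH] m /=; first by rewrite addn0.
    by split=> //; rewrite addnS -addSn.
  + by rewrite big_map /= sumE (ltr0_norm sp_lt0) ltr0_norm// mulNr divfK// gt_eqF.
  + rewrite big_map /front_potential /= sumE !potential_neg ?ltW//.
    by rewrite mulNr -(mulrA _ (s / _)) divfK// gt_eqF.
  + rewrite big_map big1 /front_ratio //= => [|j _]; rewrite shock_ratio_neg// ltW//.
- move=> [a1 [a2 [h [y [_ _ _ [h_lip h0 _] [y_pert ->]]]]]].
  split; rewrite ?big_seq1//.
  apply: List.Forall_cons; last exact: List.Forall_nil.
  split=> /=; last by rewrite y_pert.1.
    split=> //=; first by move/(lt_le_trans s0); rewrite ltxx.
    by rewrite (le_trans _ (ltW s0))// oppr_le0 ltW.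
  exact: perturbed_lipschitz y_pert (lipschitz_lipschitz_from h_lip).
- move=> ->; rewrite s0; split; rewrite ?big_nil //=.
  + by rewrite coords_Tw Wfun0 mulr0 addr0 subr0.
  + by rewrite normr0.
  + by rewrite potential_neg// mulr0 oppr0.
  + by rewrite shock_ratio_neg.
Qed.

End solver.

(** * Invariants of the list of fronts across one interaction *)

Section tracking.
Context {R : realType}.
Variables (C0 C1 eps delta A Q : R).
Implicit Types (i : wfamily) (f : front R) (e : event R) (fs : seq (front R)).
Local Notation admissible := (admissible C0 C1 eps delta A Q).
Local Notation potential := (potential eps A Q).
Local Notation shock_ratio := (shock_ratio C0 C1).
Local Notation event_factor := (event_factor C0 C1).
Local Notation front_ok := (front_ok eps delta).
Local Notation front_potential := (front_potential eps A Q).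
Local Notation front_ratio := (front_ratio C0 C1).
Local Notation emitted := (emitted eps delta).
Local Notation fan_summary := (fan_summary C0 C1 eps delta A Q).

Lemma riemann_summary (u : R * R -> R * R) lamhat kap sigma b ul ur tb xb out :
  0 < delta -> (forall i, label_ok eps (b i) (sigma i)) ->
  riemann u C0 C1 lamhat delta kap sigma b ul ur tb xb out ->
  fan_summary tb xb (coords ul) (coords ur) (`|sigma F1| + `|sigma F2|)
    (potential (b F1) (sigma F1) + potential (b F2) (sigma F2))
    (shock_ratio F1 (b F1) (sigma F1) * shock_ratio F2 (b F2) (sigma F2)) out.
Proof.
move=> delta_gt0 lbl [<- [out1 [out2 [w1 w2 ->]]]].
have s1 := wave_fan_summary A Q delta_gt0 (lbl F1) w1.
have s2 := wave_fan_summary A Q delta_gt0 (lbl F2) w2.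
exact: fan_summary_cat s1 s2.
Qed.

Lemma Forall_cat T (P : T -> Prop) (s1 s2 : seq T) :
  List.Forall P (s1 ++ s2) <-> List.Forall P s1 /\ List.Forall P s2.
Proof. exact: List.Forall_app. Qed.

Lemma Forall_cons T (P : T -> Prop) x (s : seq T) :
  List.Forall P (x :: s) <-> P x /\ List.Forall P s.
Proof. exact: List.Forall_cons_iff. Qed.

Lemma Forall_impl T (P P' : T -> Prop) (s : seq T) :
  (forall x, P x -> P' x) -> List.Forall P s -> List.Forall P' s.
Proof. by move=> PP'; elim=> *; [exact: List.Forall_nil|apply: List.Forall_cons; auto]. Qed.

Record tracked (tb : R) (c : R * R) fs : Prop := Tracked {
  tracked_ok : List.Forall (fun f => front_ok f /\ lipschitz_from tb (pos f)) fs;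
  tracked_chained : exists c', chained c fs c' }.

Definition size_of fs : R := \sum_(f <- fs) `|str f|.
Definition potential_of fs : R := \sum_(f <- fs) front_potential f.

Lemma size_of_ge0 fs : 0 <= size_of fs.
Proof. by apply: sumr_ge0. Qed.

Lemma lipschitz_fromW (tb t : R) h : tb <= t -> lipschitz_from tb h -> lipschitz_from t h.
Proof. by move=> tbt [M hM]; exists M => r s tr; apply: hM; apply: le_trans tr. Qed.

(** A big shock has strength at least [eps / 2], so its term [Q * str f >= 4] absorbs the [- 1]. *)
Lemma front_potential_ge0 f : admissible -> label_ok eps (big f) (str f) ->
  0 <= front_potential f.
Proof.
move=> adm lbl; have [expRA _ Q_ge Qeps] := admissible_bounds adm.
rewrite /front_potential; have [f0|f0] := leP (str f) 0.
  rewrite potential_neg// oppr_ge0 mulr_ge0_le0// mulr_ge0; lra.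
rewrite potential_pos//; have := lbl f0.
have h : 0 <= Q * (expR A + 1) * str f by rewrite !mulr_ge0 ?(ltW f0)//; lra.
have Q0 : 0 <= Q by lra.
case: (big f) => big_ge; last by rewrite addr0 addr_ge0// mulr_ge0 ?(ltW f0).
have N_gt0 : 0 <= 4 / eps by rewrite divr_ge0// ltW// (adm_eps_gt0 adm).
have := mulr_ge0 N_gt0 (deficit_ge0 eps (str f)).
have := ler_wpM2l Q0 big_ge; lra.
Qed.

Lemma potential_of_ge0 tb c fs : admissible -> tracked tb c fs -> 0 <= potential_of fs.
Proof.
move=> adm [+ _]; rewrite /potential_of; elim=> [|f fs' [[_ lbl _ _] _] _ IH].
  by rewrite big_nil.
by rewrite big_cons addr_ge0// front_potential_ge0.
Qed.

(** All outgoing fronts start where the incoming ones meet, so that at time [t] it suffices to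
    compare the products of their ratios. *)
Record passage (t : R) e fs fs' : Prop := Passage {
  passage_split : exists pre post out, [/\ fs = pre ++ [:: einl e; einr e] ++ post,
    fs' = pre ++ out ++ post, pos (einl e) t = pos (einr e) t,
    List.Forall (fun f => pos f t = pos (einl e) t) out
    & event_factor e * \prod_(f <- out) front_ratio f <=
      front_ratio (einl e) * front_ratio (einr e)];
  passage_drop : expR (- ((1 - ln C1) * (potential_of fs - potential_of fs'))) <=
    event_factor e;
  passage_le1 : event_factor e <= 1 }.

(** Only the two incoming fronts are replaced, and the sums change by their contribution alone. The
    bound [A] persists because the total strength does not increase. *)
Lemma interaction_passage (u : R * R -> R * R) lamhat kap tb t c e fs fs' :
  admissible -> tb <= t -> tracked tb c fs -> size_of fs <= A ->
  interaction u C0 C1 eps lamhat delta kap t e fs fs' ->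
  [/\ tracked t c fs', size_of fs' <= size_of fs & passage t e fs fs'].
Proof.
move=> adm tbt [fs_ok [c' fs_chained]] szA [pre [post [out [fsE _ posE rule [rie ->]]]]].
move: fs_ok fs_chained szA; rewrite {}fsE.
move=> /Forall_cat[pre_ok /Forall_cat[lr_ok post_ok]].
move: lr_ok => /Forall_cons[[l_ok _] /Forall_cons[[r_ok _] _]].
move=> /chained_cat[m pre_ch /chained_cat[m' [lE [rE /= m'E]] post_ch]].
rewrite /size_of /potential_of !big_cat !big_cons ?big_nil /= => szA.
have sz_pre : 0 <= \sum_(f <- pre) `|str f| by exact: size_of_ge0.
have sz_post : 0 <= \sum_(f <- post) `|str f| by exact: size_of_ge0.
have szlr : `|str (einl e)| + `|str (einr e)| <= A by lra.
have [lbl sz drop le1 rat] := event_good adm rule l_ok r_ok (esym rE) szlr (proj1 rie).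
have [out_em out_ch out_sz out_pot out_rat] :=
  riemann_summary (adm_delta_gt0 adm) lbl rie.
have later g : front_ok g /\ lipschitz_from tb (pos g) ->
    front_ok g /\ lipschitz_from t (pos g).
  by move=> [? /(lipschitz_fromW tbt)].
split.
- split.
    apply/Forall_cat; split; first exact: Forall_impl later pre_ok.
    apply/Forall_cat; split; last exact: Forall_impl later post_ok.
    by apply: Forall_impl out_em => g [].
  exists c'; apply/chained_cat; exists m => //; apply/chained_cat; exists m' => //.
  by rewrite -lE -m'E.
- by rewrite ?big_nil /= out_sz; lra.
- split=> //; last first.
    apply: le_trans drop; rewrite ler_expR lerN2.
    rewrite /potential_of !big_cat !big_cons ?big_nil /= out_pot.
    by rewrite le_eqVlt; apply/orP; left; apply/eqP; ring.
  exists pre, post, out; split=> //; last by rewrite out_rat.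
  by apply: Forall_impl out_em => g [].
Qed.

End tracking.

(** * The initial fronts, and the induction over the interaction times *)

Section initial.
Context {R : realType}.
Variables (C0 C1 eps delta A Q : R).
Implicit Types (i : wfamily) (f : front R) (e : event R) (fs : seq (front R)).
Local Notation admissible := (admissible C0 C1 eps delta A Q).
Local Notation event_factor := (event_factor C0 C1).
Local Notation front_ok := (front_ok eps delta).
Local Notation front_ratio := (front_ratio C0 C1).
Local Notation tracked := (tracked eps delta).
Local Notation potential_of := (potential_of eps A Q).

Lemma enorm_ge (p : R * R) : `|p.1| <= enorm p /\ `|p.2| <= enorm p.
Proof.
by split; rewrite -sqrtr_sqr ler_sqrt ?addr_ge0 -?expr2 ?sqr_ge0// /dotp -!expr2
  ?lerDl ?lerDr sqr_ge0.
Qed.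

Lemma ln_lipschitz (beta x y : R) : 0 < beta -> beta <= x -> beta <= y ->
  `|ln x - ln y| <= beta^-1 * `|x - y|.
Proof.
move=> beta0.
have half (a b : R) : beta <= a -> beta <= b -> ln a - ln b <= beta^-1 * `|a - b|.
  move=> a_ge b_ge; have [a0 b0] : 0 < a /\ 0 < b by split; lra.
  rewrite -ln_div ?posrE// -[a / b](subrKC 1).
  have ab : -1 < a / b - 1 by have := divr_gt0 a0 b0; lra.
  apply: le_trans (le_ln1Dx ab) _.
  have -> : a / b - 1 = b^-1 * (a - b) by field; rewrite gt_eqF.
  apply: le_trans (_ : b^-1 * `|a - b| <= _).
    by rewrite ler_pM2l ?invr_gt0// ler_norm.
  by rewrite ler_wpM2r// lef_pV2.
move=> x_ge y_ge; rewrite ler_norml half// andbT lerNl opprB distrC half//.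
Qed.

Lemma initial_tracked (u : R * R -> R * R) lamhat kap beta (g : R -> R * R) a ul js fs :
    0 < eps -> 0 < delta -> 0 < beta -> path <%R a [seq j.1 | j <- js] ->
    (forall x, a <= x -> g x = step_fun ul js x) -> (forall x, beta <= (g x).1) ->
    initial_fronts u C0 C1 eps lamhat delta kap ul js fs ->
  tracked 0 (coords ul) fs /\
  size_of fs <= (beta^-1 + 1) *
    \sum_(d <- pairmap (fun x y => enorm (g y - g x)) a [seq j.1 | j <- js]) d.
Proof.
move=> eps0 delta0 beta0.
elim: js a ul fs => [|[x ur] js IH] a ul fs /=.
  move=> _ _ _ ->; split; last by rewrite /size_of !big_nil mulr0.
  by split; [exact: List.Forall_nil|exists (coords ul)].
move=> /andP[ax xjs] gE g_ge [sigma [out [fs' [rie init ->]]]].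
have step_lt (y : R) (s : R * R) (l : seq (R * (R * R))) : path <%R y [seq j.1 | j <- l] ->
    step_fun s l y = s.
  move=> /(order_path_min lt_trans); elim: l s => //= -[z w] l IHl s /andP[yz yl].
  by rewrite /step_fun /= leNgt yz /=; exact: IHl.
have gx y : x <= y -> g y = step_fun ur js y.
  by move=> xy; rewrite gE ?(le_trans (ltW ax))// /step_fun /= xy.
have [[fs_ok [c' fs_ch]] sz] := IH _ _ _ xjs gx g_ge init.
have lbl i : label_ok eps (eps <= sigma i) (sigma i).
  by move=> _; case: leP => //; lra.
have [out_em out_ch out_sz _ _] := riemann_summary A Q delta0 lbl rie.
split.
  split; last by exists c'; apply/chained_cat; exists (coords ur).
  apply/Forall_cat; split=> //.
  by apply: Forall_impl out_em => f [].
rewrite /size_of big_cat big_cons /= out_sz mulrDr; apply: lerD => //.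
have gaE : g a = ul.
  by rewrite gE// leNgt ax /=; apply: step_lt; apply: (path_le _ ax xjs); exact: lt_trans.
have gxE : g x = ur by rewrite gx//; exact: step_lt.
rewrite gaE gxE.
have urE : coords ur = coords (Tw F2 (sigma F2) (Tw F1 (sigma F1) ul)).
  by rewrite (proj1 rie).
rewrite !coords_Tw /= [wcoord (Tw _ _ _)](congr1 fst (coords_Tw _ _ _)) /= in urE.
move: urE => [wE vE].
have [n1 n2] := enorm_ge (ur - ul).
apply: le_trans (_ : `|wcoord ur - wcoord ul| + `|ur.2 - ul.2| <= _).
  by apply: riemann_strength; [rewrite wE; ring|rewrite vE; ring].
rewrite mulrDl mul1r; apply: lerD => //.
rewrite /wcoord opprK addrC.
apply: le_trans (_ : beta^-1 * `|ul.1 - ur.1| <= _).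
  by apply: ln_lipschitz => //; rewrite -?gaE -?gxE.
by rewrite ler_wpM2l ?invr_ge0 ?(ltW beta0)// distrC.
Qed.

Lemma initial_size (u : R * R -> R * R) D lamhat u0 beta kap d T :
    0 < eps -> 0 < delta -> 0 < beta -> (total_var u0 <= T%:E)%E ->
    front_tracking u D C0 C1 eps lamhat u0 beta delta kap d ->
  tracked 0 (coords (ft_left d)) (ft_fronts d 0%N) /\
  size_of (ft_fronts d 0%N) <= (beta^-1 + 1) * (2 * T).
Proof.
move=> eps0 delta0 beta0 u0T [[jsrt tv _ g_ge] _ init _ _].
(* The variation is tested on the jump positions preceded by a point to the left of them all. *)
have head_path (s : seq R) : sorted <%R s -> path <%R (head 0 s - 1) s.
  by case: s => //= x s ->; rewrite andbT; lra.
have a_path := head_path _ jsrt.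
have [tr sz] := initial_tracked eps0 delta0 beta0 a_path (fun _ _ => erefl) g_ge init.
split=> //; apply: le_trans sz _; rewrite ler_wpM2l ?addr_ge0 ?invr_ge0 ?(ltW beta0)//.
rewrite -lee_fin; apply: le_trans (_ : total_var (psi0 d) <= _)%E.
  by apply: ereal_sup_ubound; do 2 eexists; split; first exact: a_path.
by apply: le_trans tv _; rewrite EFinM lee_pmul2l// lte_fin.
Qed.

(** This is the prefactor [C1 ^+ L * Q] of the weight after [k] interactions. *)
Definition gain (d : ft R) (k : nat) : R :=
  \prod_(j <- iota 1 k) event_factor (ft_event d j).

Lemma gainS d k : gain d k.+1 = gain d k * event_factor (ft_event d k.+1).
Proof. by rewrite /gain -[in LHS](addn1 k) iotaD big_cat big_seq1 /= add1n. Qed.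

Section induction.
Variables (u : R * R -> R * R) (D : set (R * R)) (lamhat : R).
Variables (u0 : R -> R * R) (beta kap : R) (d : ft R).
Hypothesis d_ft : front_tracking u D C0 C1 eps lamhat u0 beta delta kap d.

Lemma ft_time_ge0 k : (0 <= ft_time d k)%E.
Proof.
case: d_ft => _ [t0 t_le _ _] _ _ _.
by elim: k => [|k IH]; [rewrite t0|exact: le_trans IH (t_le k)].
Qed.

Lemma ft_time_le j k : (j <= k)%N -> (ft_time d j <= ft_time d k)%E.
Proof.
case: d_ft => _ [_ t_le _ _] _ _ _.
elim: k => [|k IH]; first by rewrite leqn0 => /eqP ->.
by rewrite leq_eqVlt => /predU1P[->//|/IH/le_trans]; apply.
Qed.

Lemma ft_time_pred k t : ft_time d k.+1 = t%:E ->
  exists2 s, ft_time d k = s%:E & s < t.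
Proof.
move=> tE; case: d_ft => _ [_ t_le t_lt _] _ _ _.
have fin : (ft_time d k < +oo)%E by apply: le_lt_trans (t_le k) _; rewrite tE ltry.
move: (ft_time_ge0 k) (t_lt k fin); rewrite tE.
by case: (ft_time d k) => // s _ st; exists s.
Qed.

Lemma ft_index_eq k t : (ft_time d k < t%:E)%E -> (t%:E <= ft_time d k.+1)%E ->
  ft_index d t = k.
Proof.
move=> kt tk; have t_gt0 : (0 < t%:E)%E by exact: le_lt_trans (ft_time_ge0 k) kt.
have lt_next j : (ft_time d j < t%:E)%E \/ j = 0%N -> (ft_time d j < t%:E)%E.
  by case=> // ->; case: d_ft => _ [-> _ _ _] _ _ _.
have before j j' : (ft_time d j < t%:E)%E -> (t%:E <= ft_time d j'.+1)%E -> (j <= j')%N.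
  move=> jt tj'; rewrite leqNgt; apply/negP => /ft_time_le /(le_trans tj').
  by rewrite leNgt jt.
rewrite /ft_index; apply: xget_unique => /=; first by split=> //; left.
move=> j [/lt_next jt tj]; apply/eqP; rewrite eqn_leq.
by rewrite (before _ _ jt tk) (before _ _ kt tj).
Qed.

(** The interaction times are unbounded, so there is a least [k] with [t <= ft_time d k.+1]. By
    minimality [ft_time d k < t] unless [k = 0], a case that covers [t = 0]. *)
Lemma ft_indexP t : 0 <= t -> exists s, [/\ ft_time d (ft_index d t) = s%:E,
  s <= t, 0 < t -> s < t & (t%:E <= ft_time d (ft_index d t).+1)%E].
Proof.
move=> t_ge0.
have [time0 t_le _ /(_ t)[m /ltW tm]] : [/\ ft_time d 0%N = 0%E,
    forall k, (ft_time d k <= ft_time d k.+1)%E,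
    forall k, (ft_time d k < +oo)%E -> (ft_time d k < ft_time d k.+1)%E
  & forall t : R, exists k, (t%:E < ft_time d k)%E] by case: d_ft.
have ex : exists k, (t%:E <= ft_time d k.+1)%E by exists m; exact: le_trans tm (t_le m).
have [k tk k_min] := ex_minnP ex.
have k_ok : ((ft_time d k < t%:E)%E \/ k = 0%N) /\ (t%:E <= ft_time d k.+1)%E.
  split=> //; case: k k_min {tk} => [|k] k_min; [by right|left].
  by rewrite ltNge; apply/negP => /k_min; rewrite ltnn.
have [] := @xgetPex _ 0%N _ (ex_intro _ k k_ok : exists k,
  [set k | ((ft_time d k < t%:E)%E \/ k = 0%N) /\ (t%:E <= ft_time d k.+1)%E] k).
rewrite -/(ft_index d t); move: (ft_index d t) => j [jt tj|-> tj]; last first.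
  by exists 0; rewrite time0; split=> //.
move: (ft_time_ge0 j) jt tj; case: (ft_time d j) => // s _.
by rewrite lte_fin => st tj; exists s; split=> //; exact: ltW.
Qed.

Hypotheses (adm : admissible).
Hypothesis d_tracked : tracked 0 (coords (ft_left d)) (ft_fronts d 0%N).
Hypothesis d_size : size_of (ft_fronts d 0%N) <= A.

(** The lower bounds on the factors multiply to the exponential of a telescoping sum of drops of the
    potential. *)
Lemma ft_tracked k t : ft_time d k = t%:E ->
  [/\ tracked t (coords (ft_left d)) (ft_fronts d k), size_of (ft_fronts d k) <= A,
      gain d k <= 1
    & expR (- ((1 - ln C1) * (potential_of (ft_fronts d 0%N) -
        potential_of (ft_fronts d k)))) <= gain d k].
Proof.
elim: k t => [|k IH] t tE.
  have t0 : t = 0 by case: d_ft => _ [+ _ _ _] _ _ _; rewrite tE => -[].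
  by rewrite t0 /gain big_nil subrr mulr0 oppr0 expR0.
have [s sE st] := ft_time_pred tE.
have [tr sz g_le g_ge] := IH _ sE.
have [_ _ _ _ [/(_ k t tE) inter _]] := d_ft.
have [tr' sz' [_ drop le1]] := interaction_passage adm (ltW st) tr sz inter.
rewrite gainS; split=> //; first exact: le_trans sz' sz.
  rewrite -[leRHS]mulr1 ler_pM//; first exact: le_trans (expR_ge0 _) g_ge.
  exact: le_trans (expR_ge0 _) drop.
have splitE x y z : - ((1 - ln C1) * (x - z)) =
    - ((1 - ln C1) * (x - y)) + - ((1 - ln C1) * (y - z)) :> R by ring.
by rewrite (splitE _ (potential_of (ft_fronts d k))) expRD ler_pM ?expR_ge0.
Qed.

Lemma ft_passage k t : ft_time d k.+1 = t%:E ->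
  passage C0 C1 eps A Q t (ft_event d k.+1) (ft_fronts d k) (ft_fronts d k.+1).
Proof.
move=> tE; have [s sE st] := ft_time_pred tE.
have [tr sz _ _] := ft_tracked sE.
have [_ _ _ _ [/(_ k t tE) inter _]] := d_ft.
by have [] := interaction_passage adm (ltW st) tr sz inter.
Qed.

End induction.
End initial.

(** * The weight as a product over all fronts *)

Lemma expR_ge1 (R : realType) (x : R) : (1 <= expR x) = (0 <= x).
Proof. by rewrite -[1](@expR0 R) ler_expR. Qed.

Section weights.

Context {R : realType}.
Variables (C0 C1 eps delta A Q : R).
Implicit Types (i : wfamily) (f : front R) (fs : seq (front R)).
Local Notation admissible := (admissible C0 C1 eps delta A Q).
Local Notation event_factor := (event_factor C0 C1).
Local Notation front_ok := (front_ok eps delta).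
Local Notation front_ratio := (front_ratio C0 C1).
Local Notation tracked := (tracked eps delta).
Local Notation potential_of := (potential_of eps A Q).
Local Notation gain := (gain C0 C1).

Definition side f (t x : R) : R := if x <= pos f t then 1 else front_ratio f.

Definition sides fs (t x : R) : R := \prod_(f <- fs) side f t x.

Lemma sides_cat fs fs' t x : sides (fs ++ fs') t x = sides fs t x * sides fs' t x.
Proof. exact: big_cat. Qed.

Lemma sides_at fs (p t x : R) : List.Forall (fun f => pos f t = p) fs ->
  sides fs t x = if x <= p then 1 else \prod_(f <- fs) front_ratio f.
Proof.
rewrite /sides; elim=> [|f fs' fp _ IH]; first by rewrite !big_nil if_same.
by rewrite !big_cons IH /side fp; case: ifP; rewrite ?mulr1.
Qed.

Lemma weightE d t x : weight C0 C1 d t x =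
  gain d (ft_index d t) * sides (fronts_at d t) t x.
Proof.
rewrite /weight /sides big_mkcond /=; congr (_ * _); last first.
  apply: eq_bigr => f _; rewrite /is_shock /side /xi /front_ratio /shock_ratio.
  by case: ifP; case: ifP.
rewrite /Lnum /Qprod /Kseq /gain; elim: (iota _ _) => [|j s IH] /=.
  by rewrite !big_nil expr0 mulr1.
by rewrite big_cons -IH big_cat /= exprD /event_factor; ring.
Qed.

(** A bound on the logarithm of [front_ratio] per unit of strength: a big shock has
    [1 <= 2 / eps * str f], which makes [- ln C1] at most proportional to its strength, and the [1]
    serves the small shocks. *)
Definition ratio_rate : R := 1 - 2 / eps * ln C1.

Lemma ratio_rate_ge0 : admissible -> 0 <= ratio_rate.
Proof.
move=> adm; have [_ lnC1 _ _] := admissible_bounds adm.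
rewrite /ratio_rate subr_ge0 (le_trans _ ler01)// mulr_ge0_le0//.
by rewrite divr_ge0// ltW// (adm_eps_gt0 adm).
Qed.

Lemma front_ratio_bounds f : admissible -> label_ok eps (big f) (str f) ->
  expR (- (ratio_rate * `|str f|)) <= front_ratio f <= expR (ratio_rate * `|str f|).
Proof.
move=> adm lbl; have [_ lnC1 _ _] := admissible_bounds adm.
have [C0_gt0 C0_lt C1_gt0 C1_le eps_gt0 eps_le _ _ _ _] := adm.
have eV : 0 < 2 / eps by rewrite divr_gt0.
have rate1 : 1 <= ratio_rate by rewrite /ratio_rate lerBrDr gerDl mulr_ge0_le0// ltW.
have [f0|f0] := leP (str f) 0.
  have h : 0 <= ratio_rate * `|str f| by rewrite mulr_ge0//; lra.
  by rewrite /front_ratio shock_ratio_neg// expR_le1 oppr_le0 h expR_ge1.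
have s_le : str f <= ratio_rate * str f by rewrite ler_peMl// ltW.
rewrite /front_ratio shock_ratio_pos// (gtr0_norm f0); have := lbl f0.
have Cs0 : 0 <= C0 * str f by rewrite mulr_ge0// ltW.
case: (big f) => lblf.
  have lnC1_le : - ln C1 <= ratio_rate * str f.
    have h : 1 <= 2 / eps * str f by rewrite mulrAC ler_pdivlMr//; lra.
    rewrite /ratio_rate mulrBl mul1r mulrAC; nra.
  have lo : expR (- (ratio_rate * str f)) <= C1.
    by rewrite -[leRHS]lnK ?posrE// ler_expR; lra.
  have hi : C1^-1 <= expR (ratio_rate * str f).
    by rewrite -[leLHS]lnK ?posrE ?invr_gt0// ler_expR lnV ?posrE//.
  have C1V : 1 <= C1^-1 by rewrite invf_ge1//; lra.
  by case: (fam f) => /=; apply/andP; split => //; lra.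
have Cs_le : C0 * str f <= 1 / 2 * str f by rewrite ler_wpM2r// ltW.
have lo : expR (- (ratio_rate * str f)) <= 1 - C0 * str f.
  apply: le_trans (expR_le_oneB _ _); [by rewrite ler_expR; lra|lra|lra].
have hi : 1 + C0 * str f <= expR (ratio_rate * str f).
  by apply: le_trans (expR_ge1Dx _) _; rewrite ler_expR; lra.
by case: (fam f) => /=; apply/andP; split; lra.
Qed.

Definition labels_ok fs := List.Forall (fun f => label_ok eps (big f) (str f)) fs.

Lemma tracked_labels tb c fs : tracked tb c fs -> labels_ok fs.
Proof. by case=> ok _; apply: Forall_impl ok => f [[]]. Qed.

Lemma sides_bounds fs t x : admissible -> labels_ok fs ->
  expR (- (ratio_rate * size_of fs)) <= sides fs t x <= expR (ratio_rate * size_of fs).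
Proof.
move=> adm; rewrite /size_of /sides; elim=> [|f fs' lbl _ /andP[lo hi]].
  by rewrite !big_nil mulr0 oppr0 expR0 lexx.
have /andP[flo fhi] := front_ratio_bounds adm lbl.
have rate0 := ratio_rate_ge0 adm.
have slo : expR (- (ratio_rate * `|str f|)) <= side f t x.
  by rewrite /side; case: ifP => // _; rewrite expR_le1 oppr_le0 mulr_ge0.
have shi : side f t x <= expR (ratio_rate * `|str f|).
  by rewrite /side; case: ifP => // _; rewrite expR_ge1 mulr_ge0.
rewrite !big_cons mulrDr opprD !expRD !ler_pM ?expR_ge0//.
  exact: le_trans (expR_ge0 _) slo.
exact: le_trans (expR_ge0 _) lo.
Qed.

Lemma sides_gt0 fs t x : admissible -> labels_ok fs -> 0 < sides fs t x.
Proof.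
move=> adm /(sides_bounds t x adm)/andP[+ _]; apply: lt_le_trans.
exact: expR_gt0.
Qed.

Lemma potential_of_le tb c fs : admissible -> tracked tb c fs ->
  potential_of fs <= (Q * (expR A + 2) + 4 / eps) * size_of fs.
Proof.
move=> adm [+ _]; rewrite /size_of /potential_of.
elim=> [|f fs' [[_ lbl _ _] _] _ IH]; first by rewrite !big_nil mulr0.
have [expRA _ Q_ge _] := admissible_bounds adm.
have N0 : 0 < 4 / eps by rewrite divr_gt0// (adm_eps_gt0 adm).
rewrite !big_cons mulrDr lerD// /front_potential /potential.
have Qs : 0 <= Q * `|str f| by rewrite mulr_ge0//; lra.
have Ns : 0 <= 4 / eps * `|str f| by rewrite mulr_ge0// ltW.
case: ifP => f0; last lra.
move: Qs Ns; rewrite (gtr0_norm f0) => Qs Ns.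
case: (big f) (lbl f0) => lblf; last lra.
(* A big shock has [eps / 2 <= str f], hence [eps - str f <= str f]. *)
have def : deficit eps (str f) <= str f.
  by rewrite /deficit ge_max (ltW f0) andbT; lra.
have := ler_wpM2l (ltW N0) def; lra.
Qed.

(** [side] depends only on the sign of [x - pos f t], which is locally constant off the front. The
    functions [g] and [h] allow for limits in time and limits in space alike. *)
Lemma side_near (F : set_system R) (FF : Filter F) f (g h : R -> R) (t x : R) :
  x != pos f t ->
  (forall e, 0 < e ->
    \forall s \near F, `|(h s - pos f (g s)) - (x - pos f t)| < e) ->
  \forall s \near F, side f (g s) (h s) = side f t x.
Proof.
move=> xp /(_ `|x - pos f t|); rewrite normr_gt0 subr_eq0 => /(_ xp).
apply: filterS => s; rewrite /side.
have -> : (x <= pos f t) = (x - pos f t <= 0) by rewrite subr_le0.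
have -> : (h s <= pos f (g s)) = (h s - pos f (g s) <= 0) by rewrite subr_le0.
set a := x - _; set b := h s - _; rewrite ltr_norml.
have a0 : a != 0 by rewrite subr_eq0.
case: (leP a 0) => ha; case: (leP b 0) => hb //.
  by rewrite ler0_norm//; lra.
by rewrite gtr0_norm//; lra.
Qed.

Lemma sides_near (F : set_system R) (FF : Filter F) fs (g h : R -> R) (t x : R) :
  List.Forall (fun f => forall e, 0 < e ->
    \forall s \near F, `|(h s - pos f (g s)) - (x - pos f t)| < e) fs ->
  x \notin [seq pos f t | f <- fs] ->
  \forall s \near F, sides fs (g s) (h s) = sides fs t x.
Proof.
elim=> [|f fs' f_near _ IH] /=; first by rewrite /sides => _; near=> s; rewrite !big_nil.
rewrite inE negb_or => /andP[xf /IH near_fs'].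
near=> s; rewrite /sides !big_cons; congr (_ * _).
  by near: s; exact: side_near xf f_near.
by near: s.
Unshelve. all: by end_near. Qed.

Lemma lipschitz_near_left (tb t x : R) (p : R -> R) : tb < t -> lipschitz_from tb p ->
  forall e, 0 < e -> \forall s \near t^'-, `|(x - p s) - (x - p t)| < e.
Proof.
move=> tbt [M pM] e e0; pose M' := `|M| + 1.
have M'0 : 0 < M' by rewrite ltr_wpDl.
near=> s.
have st : s <= t by apply: ltW; near: s; exact: nbhs_left_lt.
have tbs : tb <= s by apply: ltW; near: s; exact: nbhs_left_gt.
have -> : x - p s - (x - p t) = p t - p s by ring.
apply: le_lt_trans (pM _ _ tbs st) _.
have ts : t - s < e / M' by near: s; apply: nbhs_left_ltBl; rewrite divr_gt0.
rewrite ltr_pdivlMr// in ts.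
apply: le_lt_trans ts; rewrite mulrC ler_wpM2l ?subr_ge0// /M'.
by have := ler_norm M; lra.
Unshelve. all: by end_near. Qed.

Lemma lipschitz_near_right (t x : R) (p : R -> R) : lipschitz_from t p ->
  forall e, 0 < e -> \forall s \near t^'+, `|(x - p s) - (x - p t)| < e.
Proof.
move=> [M pM] e e0; pose M' := `|M| + 1.
have M'0 : 0 < M' by rewrite ltr_wpDl.
near=> s.
have ts : t <= s by apply: ltW; near: s; exact: nbhs_right_gt.
have -> : x - p s - (x - p t) = - (p s - p t) by ring.
rewrite normrN; apply: le_lt_trans (pM _ _ (lexx _) ts) _.
have st : s - t < e / M' by near: s; apply: nbhs_right_ltDr; rewrite divr_gt0.
rewrite ltr_pdivlMr// in st.
apply: le_lt_trans st; rewrite mulrC ler_wpM2l ?subr_ge0// /M'.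
by have := ler_norm M; lra.
Unshelve. all: by end_near. Qed.

Lemma ae_notin (s : seq R) (P : R -> Prop) :
  (forall x, x \notin s -> P x) -> {ae lebesgue_measure, forall x, P x}.
Proof.
move=> sP; have s_countable : countable [set` s] by exact: finite_set_countable.
exists [set` s]; split.
- by apply: countable_measurable => // r; exact: measurable_set1.
- exact: countable_lebesgue_measure0.
- by move=> x /= nPx; apply/negPn/negP => /sP.
Qed.

End weights.

(** * Bounds, monotonicity and jumps of the weight *)

Section front_tracking_weight.
Context {R : realType}.
Variables (C0 C1 eps delta A Q : R).
Implicit Types (i : wfamily) (f : front R) (fs : seq (front R)).
Local Notation admissible := (admissible C0 C1 eps delta A Q).
Local Notation event_factor := (event_factor C0 C1).
Local Notation front_ratio := (front_ratio C0 C1).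
Local Notation tracked := (tracked eps delta).
Local Notation potential_of := (potential_of eps A Q).
Local Notation gain := (gain C0 C1).
Local Notation sides := (sides C0 C1).
Local Notation side := (side C0 C1).
Variables (u : R * R -> R * R) (D : set (R * R)) (lamhat : R).
Variables (u0 : R -> R * R) (beta kap : R) (d : ft R).
Hypothesis d_ft : front_tracking u D C0 C1 eps lamhat u0 beta delta kap d.
Hypotheses (adm : admissible).
Hypothesis d_tracked : tracked 0 (coords (ft_left d)) (ft_fronts d 0%N).
Hypothesis d_size : size_of (ft_fronts d 0%N) <= A.

Let tracking := ft_tracked d_ft adm d_tracked d_size.

(** The potential never becomes negative, so its total drop is at most its initial value, which is
    bounded linearly by the total strength and hence independently of [k] and [delta]. *)
Lemma gain_ge k t : ft_time d k = t%:E ->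
  expR (- ((1 - ln C1) * ((Q * (expR A + 2) + 4 / eps) * A))) <= gain d k.
Proof.
move=> tE; have [tr sz _] := tracking tE; apply: le_trans.
have [expRA lnC1 Q_ge _] := admissible_bounds adm.
have N0 : 0 < 4 / eps by rewrite divr_gt0// (adm_eps_gt0 adm).
have QN : 0 <= Q * (expR A + 2) + 4 / eps by rewrite addr_ge0 ?(ltW N0)// mulr_ge0//; lra.
rewrite ler_expR lerN2 ler_wpM2l//; first lra.
apply: le_trans (_ : potential_of (ft_fronts d 0%N) <= _).
  by rewrite gerBl (potential_of_ge0 adm tr).
by apply: le_trans (potential_of_le adm d_tracked) _; rewrite ler_wpM2l.
Qed.

Lemma gain_gt0 k t : ft_time d k = t%:E -> 0 < gain d k.
Proof. by move=> /gain_ge; apply: lt_le_trans; exact: expR_gt0. Qed.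

Lemma weight_bounds t x : 0 <= t ->
  expR (- ((1 - ln C1) * ((Q * (expR A + 2) + 4 / eps) * A))) *
    expR (- (ratio_rate C1 eps * A)) <= weight C0 C1 d t x
  <= expR (ratio_rate C1 eps * A).
Proof.
move=> t0; have [s [sE _ _ _]] := ft_indexP d_ft t0.
have [tr sz g1 _] := tracking sE.
have g_ge := gain_ge sE.
have /andP[lo hi] := sides_bounds t x adm (tracked_labels tr).
have rate0 := ratio_rate_ge0 adm.
rewrite weightE /fronts_at; apply/andP; split.
  rewrite ler_pM ?expR_ge0//; apply: le_trans lo.
  by rewrite ler_expR lerN2 ler_wpM2l.
rewrite -[leRHS]mul1r ler_pM//; first exact: le_trans (expR_ge0 _) g_ge.
  exact: le_trans (expR_ge0 _) lo.
by apply: le_trans hi _; rewrite ler_expR ler_wpM2l.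
Qed.

(** Near the limit the list of fronts is fixed and no front crosses [x], so the weight is eventually
    constant. *)
Lemma weight_near (F : set_system R) (FF : Filter F) k t x :
    (\forall s \near F, ft_index d s = k) ->
    List.Forall (fun f => forall e, 0 < e ->
      \forall s \near F, `|(x - pos f s) - (x - pos f t)| < e) (ft_fronts d k) ->
    x \notin [seq pos f t | f <- ft_fronts d k] ->
  weight C0 C1 d s x @[s --> F] --> gain d k * sides (ft_fronts d k) t x.
Proof.
move=> sk f_near xp; apply: cvg_near_cst.
have near_sides := @sides_near _ C0 C1 F FF (ft_fronts d k) id (fun=> x) t x f_near xp.
near=> s; rewrite weightE /fronts_at (_ : ft_index d s = k); last by near: s.
by congr (_ * _); near: s.
Unshelve. all: by end_near. Qed.

Lemma weight_interaction t : 0 < t -> interaction_time d t ->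
  {ae lebesgue_measure, forall x : R, exists am ap : R,
    [/\ weight C0 C1 d s x @[s --> t^'-] --> am,
        weight C0 C1 d s x @[s --> t^'+] --> ap & ap <= am]}.
Proof.
move=> t0 [k tE]; have [r rE rt] := ft_time_pred d_ft tE.
have [tr _ _ _] := tracking rE; have [tr' _ _ _] := tracking tE.
have [pass _ le1] := ft_passage d_ft adm d_tracked d_size tE.
have tlt : (t%:E < ft_time d k.+2)%E.
  case: d_ft => _ [_ _ t_lt _] _ _ _; rewrite -tE; apply: t_lt; by rewrite tE ltry.
have left_index : \forall s \near t^'-, ft_index d s = k.
  near=> s; apply: (ft_index_eq d_ft); first rewrite rE lte_fin.
    by near: s; exact: nbhs_left_gt.
  by rewrite tE lee_fin ltW//; near: s; exact: nbhs_left_lt.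
have right_index : \forall s \near t^'+, ft_index d s = k.+1.
  have [t' tt' t'k] : exists2 t', t < t' & (t'%:E <= ft_time d k.+2)%E.
    move: tlt; case: (ft_time d k.+2) => [t'| |] //; rewrite ?lte_fin => tt'.
      by exists t'.
    by exists (t + 1); rewrite ?ltrDl// leey.
  near=> s; apply: (ft_index_eq d_ft).
    by rewrite tE lte_fin; near: s; exact: nbhs_right_gt.
  by apply: le_trans t'k; rewrite lee_fin ltW//; near: s; exact: nbhs_right_lt.
(* The exceptional null set consists of the finitely many positions at time [t] of the fronts
   present before or after the interaction. *)
apply: (@ae_notin _ ([seq pos f t | f <- ft_fronts d k] ++
  [seq pos f t | f <- ft_fronts d k.+1])) => x; rewrite mem_cat negb_or => /andP[xk xk'].
exists (gain d k * sides (ft_fronts d k) t x),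
  (gain d k.+1 * sides (ft_fronts d k.+1) t x); split.
- apply: weight_near => //; apply: Forall_impl (tracked_ok tr) => f [_].
  exact: lipschitz_near_left.
- apply: weight_near => //; apply: Forall_impl (tracked_ok tr') => f [_].
  exact: lipschitz_near_right.
rewrite gainS -mulrA ler_pM2l ?(gain_gt0 rE)//.
have [pre [post [out [fsE fs'E posE out_pos rat]]]] := pass.
have [pre0 post0] : 0 <= sides pre t x /\ 0 <= sides post t x.
  have := tracked_labels tr; rewrite fsE => /Forall_cat[ok1 /Forall_cat[_ ok2]].
  by split; apply: ltW; [exact: sides_gt0 adm ok1|exact: sides_gt0 adm ok2].
rewrite fsE fs'E !sides_cat.
set oute := sides out t x; set ine := sides [:: _; _] t x.
(* The fronts in [pre] and [post] contribute the same nonnegative factors before and after. *)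
suff io : event_factor (ft_event d k.+1) * oute <= ine.
  have -> : event_factor (ft_event d k.+1) * (sides pre t x * (oute * sides post t x)) =
    sides pre t x * (event_factor (ft_event d k.+1) * oute * sides post t x) by ring.
  by rewrite ler_wpM2l// ler_wpM2r.
have in_pos : List.Forall (fun f => pos f t = pos (einl (ft_event d k.+1)) t)
    [:: einl (ft_event d k.+1); einr (ft_event d k.+1)].
  by rewrite !Forall_cons posE; split=> //; split=> //; exact: List.Forall_nil.
(* To the left of the meeting point both products are [1] and the event factor is at most [1]; to
   the right the claim is [rat]. *)
rewrite /oute /ine (sides_at _ _ _ out_pos) (sides_at _ _ _ in_pos).
by case: ifP; rewrite ?mulr1// !big_cons big_nil mulr1.
Unshelve. all: by end_near. Qed.

(** Between interactions the positions are strictly ordered, so no other front sits at [pos f t] and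
    the product over the other fronts is constant nearby. *)
Lemma weight_jump t f : 0 < t -> ~ interaction_time d t -> present d t f ->
  exists am ap : R,
    [/\ weight C0 C1 d t y @[y --> (pos f t)^'-] --> am,
        weight C0 C1 d t y @[y --> (pos f t)^'+] --> ap,
        0 < am & ap = am * front_ratio f].
Proof.
move=> t0 no_int [pre [post fsE]]; have [r [rE _ /(_ t0) rt tle]] := ft_indexP d_ft (ltW t0).
have [tr _ _ _] := tracking rE.
have srt : sorted <%R [seq pos g t | g <- fronts_at d t].
  have [_ _ _ order _] := d_ft; apply: order; rewrite rE lte_fin rt /= lt_neqAle tle andbT.
  by apply/eqP => tE; apply: no_int; exists (ft_index d t).
have := lt_sorted_uniq srt; rewrite fsE map_cat /= cat_uniq /= negb_or.
case/and3P=> _ /andP[f_pre _] /andP[f_post _].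
have rest_near (F : set_system R) (FF : Filter F) : F `=>` nbhs (pos f t) ->
    \forall y \near F, sides (pre ++ post) t y = sides (pre ++ post) t (pos f t).
  move=> F_near; apply: (@sides_near _ C0 C1 F FF (pre ++ post) (fun=> t) id t (pos f t)).
    elim: (pre ++ post) => [|g gs IH]; first exact: List.Forall_nil.
    apply: List.Forall_cons => // e e0.
    have : \forall y \near F, `|pos f t - y| < e by apply: F_near; exact: nbhsx_ballx.
    apply: filterS => y; rewrite distrC; congr (`|_| < _); ring.
  by rewrite map_cat mem_cat negb_or f_pre.
have splitE y : sides (fronts_at d t) t y = side f t y * sides (pre ++ post) t y.
  by rewrite fsE !sides_cat /sides big_cons mulrCA.
set w := gain d (ft_index d t) * sides (pre ++ post) t (pos f t).
exists w, (w * front_ratio f); split=> //.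
- apply: cvg_near_cst.
  have rest : \forall y \near (pos f t)^'-,
      sides (pre ++ post) t y = sides (pre ++ post) t (pos f t).
    by apply: rest_near; exact: cvg_within.
  near=> y.
  have yp : y < pos f t by near: y; exact: nbhs_left_lt.
  by rewrite weightE splitE (near rest y)// /side (ltW yp) mul1r.
- apply: cvg_near_cst.
  have rest : \forall y \near (pos f t)^'+,
      sides (pre ++ post) t y = sides (pre ++ post) t (pos f t).
    by apply: rest_near; exact: cvg_within.
  near=> y.
  have yp : pos f t < y by near: y; exact: nbhs_right_gt.
  by rewrite weightE splitE (near rest y)// /side leNgt yp /w /=; ring.
rewrite mulr_gt0 ?(gain_gt0 rE)//; apply: (sides_gt0 _ _ adm).
have := tracked_labels tr; rewrite -/(fronts_at d t) fsE.
move=> /Forall_cat[ok1 /Forall_cons[_ ok2]].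
exact/Forall_cat.
Unshelve. all: by end_near. Qed.

End front_tracking_weight.

Theorem proposition6p1 (R : realType) (Mh ch Ch : R) (D : set (R * R))
    (C0 lamhat : R)
    (Mh_gt0 : 0 < Mh) (ch_gt0 : 0 < ch) (Ch_gt0 : 0 < Ch)
    (D_compact : compact D) (D_pos : D `<=` [set p | 0 < p.1])
    (V0_D : V0 Mh ch Ch `<=` D)
    (C0_gt0 : 0 < C0) (C0_lt : C0 < 1 / 2) (lamhat_gt0 : 0 < lamhat) :
  (* C1 and eps are taken sufficiently small *)
  exists eps_max C1_max : R, 0 < eps_max /\ 0 < C1_max /\
  forall C1 eps : R, 0 < C1 -> C1 < 1 -> C1 <= C1_max ->
    0 < eps -> eps <= eps_max -> C0 * eps <= 1 / 2 ->
    shift_property Mh ch Ch D C0 C1 eps lamhat ->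
  forall (u0 : R -> R * R) (beta : R) (u : R * R -> R * R),
    (total_var u0 < +oo)%E -> Linfty setT u0 ->
    0 < beta -> {ae lebesgue_measure, forall x, beta <= (u0 x).1} ->
    S_weak Mh ch Ch u ->
  exists cbar Cbar : R, 0 < cbar /\ 0 < Cbar /\
  forall (delta kap : R) (d : ft R), 0 < delta -> delta < eps / 2 -> 0 <= kap ->
    front_tracking u D C0 C1 eps lamhat u0 beta delta kap d ->
  let a := weight C0 C1 d in
  [/\ forall t x, 0 <= t -> cbar <= a t x <= Cbar,
      forall t, 0 < t -> interaction_time d t ->
        {ae lebesgue_measure, forall x, exists am ap : R,
          [/\ a s x @[s --> t^'-] --> am, a s x @[s --> t^'+] --> ap
            & ap <= am]}
    & forall t f, 0 < t -> ~ interaction_time d t -> present d t f ->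
        is_shock f ->
        exists am ap : R,
          [/\ a t y @[y --> (pos f t)^'-] --> am,
              a t y @[y --> (pos f t)^'+] --> ap,
              big f -> ap / am = (if fam f is F1 then C1 else 1 / C1)
            & ~~ big f -> ap / am = (if fam f is F1 then 1 - C0 * str f
                                     else 1 + C0 * str f)]].
Proof.
(* With [C0 < 1 / 2], these thresholds give [C0 * sigma <= 1 / 4] for every small shock and put [C1]
   below the product of the ratios of any two small shocks. *)
exists (1 / 2), (1 / 4); split; first by lra.
split; first by lra.
move=> C1 eps C1_gt0 C1_lt C1_le eps_gt0 eps_le _ _ u0 beta u tv_fin _ beta_gt0 _ _.
have [T T_ge0 tv_T] : exists2 T : R, 0 <= T & (total_var u0 <= T%:E)%E.
  move: tv_fin; case: (total_var u0) => [T| |] // _; last by exists 0; rewrite ?leNye.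
  by exists `|T|; rewrite ?lee_fin ?ler_norm.
(* [A] is the bound of [initial_size] on the total strength of the initial fronts, and [Q] is the
   least value that [admissible] allows. *)
pose A := (beta^-1 + 1) * (2 * T).
pose Q := 16 * (expR A + 2) / (eps / 2) ^+ 3.
have A_ge0 : 0 <= A.
  by rewrite mulr_ge0 ?addr_ge0 ?mulr_ge0// invr_ge0 ltW.
have Q_ge : 16 * (expR A + 2) <= Q * (eps / 2) ^+ 3.
  by rewrite divfK// expf_neq0// mulf_neq0// gt_eqF.
(* These constants are built from [C1], [eps], [beta] and [T] only, hence are uniform in [delta]. *)
exists (expR (- ((1 - ln C1) * ((Q * (expR A + 2) + 4 / eps) * A))) *
   expR (- (ratio_rate C1 eps * A))), (expR (ratio_rate C1 eps * A)).
split; first by rewrite mulr_gt0 ?expR_gt0.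
split; first exact: expR_gt0.
move=> delta kap d delta_gt0 delta_lt kap_ge0 d_ft a.
have adm : admissible C0 C1 eps delta A Q by split.
have [tr sz] := initial_size A Q eps_gt0 delta_gt0 beta_gt0 tv_T d_ft.
split.
- by move=> t x t_ge0; exact: weight_bounds d_ft adm tr sz _ _ t_ge0.
- by move=> t; exact: weight_interaction d_ft adm tr sz t.
- move=> t f t_gt0 no_int f_in f_shock.
  have [am [ap [am_lim ap_lim am_gt0 apE]]] := weight_jump d_ft adm tr sz t_gt0 no_int f_in.
  have quotient : ap / am = jump_ratio C0 C1 (fam f) (big f) (str f).
    by rewrite apE mulrAC divff ?gt_eqF// mul1r /front_ratio shock_ratio_pos.
  exists am, ap; split=> //; rewrite quotient.
    by case: (fam f) => -> //=; rewrite div1r.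
  by case: (fam f) => /negbTE ->.
Qed.
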